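(* Let $d\ge 3$ and $k\ge 1$ be integers. Then the minimization problem $$\inf\{P(\Omega)^{\frac{2}{d-1}}\mu_k(\Omega) : \Omega\subset\mathbb{R}^d \text{ nonempty, bounded, open and convex}\}$$ has no solution, i.e. the infimum is not attained by any nonempty bounded open convex set $\Omega\subset\mathbb{R}^d$.
   Context: For a nonempty bounded open convex set $\Omega\subset\mathbb{R}^d$, $P(\Omega)$ denotes its perimeter, i.e. the $(d-1)$-dimensional Hausdorff measure of $\partial\Omega$, and $0=\mu_0(\Omega)<\mu_1(\Omega)\le\mu_2(\Omega)\le\cdots$ denote the eigenvalues, counted with multiplicity, of the Neumann Laplacian on $\Omega$: $\mu$ is an eigenvalue if there is $0\ne u\in H^1(\Omega)$ with $\int_\Omega\nabla u\cdot\nabla\varphi=\mu\int_\Omega u\varphi$ for all $\varphi\in H^1(\Omega)$. *)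

(* Defs.v *)
From HB Require Import structures.
From mathcomp Require Import all_boot all_order all_algebra.
From mathcomp Require Import all_classical all_reals all_analysis.
Set Implicit Arguments.
Unset Strict Implicit.
Unset Printing Implicit Defensive.
Import Order.TTheory GRing.Theory Num.Theory.
Import numFieldNormedType.Exports.
Local Open Scope classical_set_scope.
Local Open Scope ring_scope.

Definition rV_display : measure_display.
Proof. exact: default_measure_display. Qed.

(* R^n is 'rV[R]_n with the product sigma-algebra, i.e. the one generated by
   the n coordinates; it coincides with the Borel sigma-algebra. *)
Section measurable_rV.
Context (R : realType) (n : nat).

Let coor (i : 'I_n) (x : 'rV[R]_n) : measurableTypeR R := x ord0 i.

Let rV_set0 : g_sigma_preimage coor set0.
Proof. exact: sigma_algebra0. Qed.

Let rV_setC A : g_sigma_preimage coor A -> g_sigma_preimage coor (~` A).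
Proof. exact: sigma_algebraC. Qed.

Let rV_bigcup (F : (set 'rV[R]_n)^nat) :
  (forall i, g_sigma_preimage coor (F i)) ->
  g_sigma_preimage coor (\bigcup_i F i).
Proof. exact: sigma_algebra_bigcup. Qed.

HB.instance Definition _ := @isMeasurable.Build rV_display 'rV[R]_n
  (g_sigma_preimage coor) rV_set0 rV_setC rV_bigcup.

Lemma measurable_coor (i : 'I_n) :
  measurable_fun [set: 'rV[R]_n]
    (fun x : 'rV[R]_n => x ord0 i : measurableTypeR R).
Proof.
move=> _ Y mY; rewrite setTI; apply: sub_sigma_algebra => /=.
rewrite -bigcup_seq/=; exists i => /=; first by rewrite mem_index_enum.
by exists Y => //; rewrite setTI.
Qed.

Lemma measurable_fun_rV d (T : measurableType d) (f : T -> 'rV[R]_n) :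
  (forall i, measurable_fun [set: T]
    (fun x => f x ord0 i : measurableTypeR R)) ->
  measurable_fun [set: T] f.
Proof.
move=> mf _ Y mY; rewrite setTI.
have : preimage_set_system setT f (g_sigma_preimage coor) `<=` measurable.
  rewrite /g_sigma_preimage -g_sigma_preimageE.
  apply: smallest_sub; first exact: sigma_algebra_measurable.
  move=> _ [A + <-]; rewrite -bigcup_seq/= => -[i _ [B mB <-]].
  rewrite 2!setTI; have := mf i measurableT B mB; rewrite setTI; exact.
by apply; exists Y => //; rewrite setTI.
Qed.

End measurable_rV.

Section lebesgue_step.
Context (R : realType) (n : nat).

Definition rV_cons (p : measurableTypeR R * 'rV[R]_n) : 'rV[R]_n.+1 :=
  \row_i oapp (p.2 ord0) p.1 (unlift ord0 i).

Let rV_uncons (x : 'rV[R]_n.+1) : measurableTypeR R * 'rV[R]_n :=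
  (x ord0 ord0, \row_j x ord0 (lift ord0 j)).

Let rV_consK : cancel rV_cons rV_uncons.
Proof.
move=> [a v]; rewrite /rV_uncons /rV_cons mxE unlift_none/=; congr pair.
by apply/rowP => j; rewrite !mxE liftK.
Qed.

Lemma measurable_rV_cons : measurable_fun setT rV_cons.
Proof.
apply: measurable_fun_rV => i; rewrite /rV_cons.
case: (unliftP ord0 i) => [j ->|->].
  rewrite (_ : (fun _ => _) = (fun v : 'rV[R]_n => v ord0 j : measurableTypeR R)
    \o snd); last by apply/funext => p /=; rewrite mxE liftK.
  by apply: measurableT_comp => //; exact: measurable_coor.
rewrite (_ : (fun _ => _) = fst)//.
by apply/funext => p; rewrite mxE unlift_none.
Qed.

Let measurable_rV_uncons : measurable_fun setT rV_uncons.
Proof.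
apply: measurable_fun_pair; first exact: measurable_coor.
apply: measurable_fun_rV => i; under eq_fun do rewrite mxE.
exact: measurable_coor.
Qed.

Variable m : {sigma_finite_measure set 'rV[R]_n -> \bar R}.

(* the image of (Lebesgue measure on R) x m under R x R^n ~ R^(n+1) *)
Definition rV_step : set 'rV[R]_n.+1 -> \bar R :=
  pushforward (@lebesgue_measure R \x m)%E rV_cons.

Let rV_step0 : rV_step set0 = 0%E.
Proof. by rewrite /rV_step /pushforward preimage_set0 measure0. Qed.

Let rV_step_ge0 A : (0 <= rV_step A)%E.
Proof. by rewrite /rV_step /pushforward; exact: measure_ge0. Qed.

Let rV_step_sigma_additive : semi_sigma_additive rV_step.
Proof.
have := @measure_semi_sigma_additive _ _ _
  (measure_function_pushforward__canonical__measure_function_Measure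
    (@lebesgue_measure R \x m)%E measurable_rV_cons).
exact.
Qed.

HB.instance Definition _ := isMeasure.Build _ _ _ rV_step
  rV_step0 rV_step_ge0 rV_step_sigma_additive.

Let rV_step_sigma_finite : sigma_finite setT rV_step.
Proof.
have /sigma_finiteP[F [FT Fnd Foo]] := sigma_finiteT (@lebesgue_measure R).
have /sigma_finiteP[G [GT Gnd Goo]] := sigma_finiteT m.
exists (fun k => rV_uncons @^-1` (F k `*` G k)) => [|k].
  apply/seteqP; split => // x _.
  have : setT (rV_uncons x).1 by [].
  have : setT (rV_uncons x).2 by [].
  rewrite FT GT => -[j _ Gj] [i _ Fi].
  exists (maxn i j) => //; split => /=.
    by move: Fi; exact/subsetPset/Fnd/leq_maxl.
  by move: Gj; exact/subsetPset/Gnd/leq_maxr.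
have [mF Fk] := Foo k; have [mG Gk] := Goo k.
split.
  rewrite -[X in measurable X]setTI; apply: measurable_rV_uncons => //.
  exact: measurableX.
rewrite /rV_step /pushforward -comp_preimage.
rewrite (_ : rV_uncons \o rV_cons = id); last first.
  by apply/funext => p /=; rewrite rV_consK.
rewrite preimage_id product_measure1E//.
by rewrite lte_mul_pinfty// ge0_fin_numE.
Qed.

HB.instance Definition _ := Measure_isSigmaFinite.Build _ _ _ rV_step
  rV_step_sigma_finite.

End lebesgue_step.

Fixpoint lebesgue_rV (R : realType) (n : nat) :
    {sigma_finite_measure set 'rV[R]_n -> \bar R} :=
  match n with
  | 0 => (\d_(0 : 'rV[R]_0) : {sigma_finite_measure set 'rV[R]_0 -> \bar R})
  | n'.+1 => (rV_step (lebesgue_rV R n')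
               : {sigma_finite_measure set 'rV[R]_n'.+1 -> \bar R})
  end.

(* The library norm on 'rV[R]_n is the sup norm; lengths and diameters below
   are Euclidean. *)
Definition enorm (R : realType) (n : nat) (x : 'rV[R]_n) : R :=
  Num.sqrt (\sum_i x ord0 i ^+ 2).

Section hausdorff.
Context (R : realType) (n : nat).
Implicit Types A U : set 'rV[R]_n.

(* 0 is thrown in so that the empty set has diameter 0 instead of -oo *)
Definition ediam U : \bar R :=
  ereal_sup (0%E |` [set (enorm (x - y))%:E | x in U & y in U]).

Definition unit_ball_volume (m : nat) : \bar R :=
  lebesgue_rV R m [set x | enorm x <= 1].

(* Normalized so as to agree with the m-dimensional area on smooth
   m-dimensional surfaces. Meaningful for 0 < m only: in expe, 0 ^+ 0 = 1, so
   for m = 0 empty sets would be counted. *)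
Definition hausdorff_pre (m : nat) (delta : R) A : \bar R :=
  ereal_inf
    [set (\sum_(0 <= i <oo)
            unit_ball_volume m * (ediam (U i) * (2^-1)%:E) ^+ m)%E
    | U in [set U : (set 'rV[R]_n)^nat |
        A `<=` \bigcup_i U i /\ forall i, (ediam (U i) <= delta%:E)%E]].

Definition hausdorff (m : nat) A : \bar R :=
  ereal_sup [set hausdorff_pre m delta A | delta in [set delta | 0 < delta]].

Definition perimeter (Omega : set 'rV[R]_n) : \bar R :=
  hausdorff n.-1 (closure Omega `\` Omega^°).

End hausdorff.

Section sobolev.
Context (R : realType) (d : nat).
Implicit Types (Omega : set 'rV[R]_d) (u v phi : 'rV[R]_d -> R).
Implicit Types (g h : 'I_d -> 'rV[R]_d -> R).
Local Notation leb := (lebesgue_rV R d).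

Definition partial (i : 'I_d) phi : 'rV[R]_d -> R :=
  fun x => 'D_(delta_mx ord0 i) phi x.

(* All iterated partial derivatives are Frechet differentiable everywhere,
   i.e. phi is C^oo. *)
Definition smooth phi : Prop :=
  forall (s : seq 'I_d) (x : 'rV[R]_d), differentiable (foldr partial phi s) x.

Definition test_function Omega phi : Prop :=
  [/\ smooth phi,
      compact (closure [set x | phi x != 0]) &
      closure [set x | phi x != 0] `<=` Omega].

(* Functions on Omega are represented by functions on R^d whose values outside
   Omega are irrelevant. *)
Definition L2 Omega u : Prop :=
  measurable_fun Omega u /\ leb.-integrable Omega (fun x => (u x ^+ 2)%:E).

Definition weak_gradient Omega u g : Prop :=
  forall i phi, test_function Omega phi ->
    \int[leb]_(x in Omega) (u x * partial i phi x) =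
    - \int[leb]_(x in Omega) (g i x * phi x).

(* u belongs to H^1(Omega) and its gradient is g *)
Definition H1 Omega u g : Prop :=
  [/\ L2 Omega u, forall i, L2 Omega (g i) & weak_gradient Omega u g].

Definition neumann_solution Omega (mu : R) u : Prop :=
  exists2 g, H1 Omega u g &
    forall v h, H1 Omega v h ->
      \int[leb]_(x in Omega) (\sum_i g i x * h i x) =
      mu * \int[leb]_(x in Omega) (u x * v x).

Definition is_zero_on Omega u : Prop :=
  {ae leb, forall x, Omega x -> u x = 0}.

Definition is_eigenvalue Omega (mu : R) : Prop :=
  exists2 u, neumann_solution Omega mu u & ~ is_zero_on Omega u.

Definition free_on Omega (n : nat) (u : 'I_n -> 'rV[R]_d -> R) : Prop :=
  forall c : 'I_n -> R,
    is_zero_on Omega (fun x => \sum_i c i * u i x) -> forall i, c i = 0.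

Definition multiplicity Omega (mu : R) : \bar R :=
  ereal_sup [set (n%:R)%:E | n in [set n | exists u : 'I_n -> 'rV[R]_d -> R,
    (forall i, neumann_solution Omega mu (u i)) /\ free_on Omega u]].

(* number of eigenvalues <= lambda, counted with multiplicity *)
Definition eigenvalue_count Omega (lambda : R) : \bar R :=
  \esum_(mu in [set mu | is_eigenvalue Omega mu /\ mu <= lambda])
    multiplicity Omega mu.

(* mu_k: since the numbering starts at mu_0, this is the least eigenvalue
   lambda such that at least k + 1 eigenvalues are <= lambda; it is +oo if
   there are fewer than k + 1 eigenvalues. *)
Definition neumann_eigenvalue (k : nat) Omega : \bar R :=
  ereal_inf [set lambda%:E | lambda in [set lambda |
    is_eigenvalue Omega lambda /\
    ((k.+1)%:R%:E <= eigenvalue_count Omega lambda)%E]].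

Definition admissible Omega : Prop :=
  [/\ Omega !=set0, bounded_set Omega, open Omega & convex_set Omega].

Definition shape_functional (k : nat) Omega : \bar R :=
  (perimeter Omega `^ (2 / d.-1%:R) * neumann_eigenvalue k Omega)%E.

End sobolev.

(* Main.v *)
Require Import Defs.
From mathcomp Require Import all_boot all_order all_algebra.
From mathcomp Require Import all_classical all_reals all_analysis.
From mathcomp Require Import measurable_realfun ring lra.
Import Order.TTheory GRing.Theory Num.Theory.
Import numFieldNormedType.Exports.
Local Open Scope classical_set_scope.
Local Open Scope ring_scope.
Set Implicit Arguments.
Unset Strict Implicit.
Unset Printing Implicit Defensive.

(** The infimum is 0, whereas the functional is positive at each admissible
    set, so no admissible set attains it.

    The infimum is 0 because of long boxes.  Let B be the box with one side of
    length M and all other sides of length 1.  Its boundary is covered by a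
    number of small cells proportional to M, so P(B) <= C M
    ([perimeter_long_box_le]).  The waves cos (j pi x_0 / M), 0 <= j <= k, are
    Neumann eigenfunctions for k + 1 distinct eigenvalues at most (k pi / M)^2
    ([neumann_eigenvalue_obox_le]).  As the exponent 2 / (d - 1) is at most 1,
    the functional is at most a constant times M * M^-2, which tends to 0.

    The functional is positive because both factors are.  The boundary of a
    bounded open set projects onto a set containing a small box of the
    hyperplane, hence it has positive perimeter ([perimeter_gt0]).  For the
    eigenvalue, the core is a Poincare inequality on a bounded open convex set:
    the double integral of (u x - u y)^2 is bounded by a constant times the
    integral of the squared gradient ([poincare]).  It gives a gap c > 0 such
    that 0 is the only eigenvalue below c ([eigenvalue_gap]), and shows that
    the eigenfunctions for 0 are constant ([multiplicity0_le1]); so mu_k is at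
    least c when k >= 1.

    The Poincare inequality comes from the identity
      u (x + h) - u x = int_0^1 (h . grad u) (x + t h) dt
    valid for almost every x when grad u is only a weak gradient
    ([translation_identity]).  It is obtained by testing both sides against
    bump functions, for which the identity is the fundamental theorem of
    calculus.  The test functions are products over the coordinates of
    functions of one variable built from exp (- s / t); smoothness is checked
    once and for all on an inductive class of such functions that is closed
    under differentiation ([elementary]). *)

(** * Boxes and the Lebesgue measure *)

Section boxes.
Context (R : realType).
Implicit Types n : nat.

Definition rbox n (a b : 'rV[R]_n) : set 'rV[R]_n :=
  [set x | forall i, a ord0 i <= x ord0 i <= b ord0 i].

Lemma measurable_coordR n (i : 'I_n) :
  measurable_fun [set: 'rV[R]_n] (fun x : 'rV[R]_n => x ord0 i).
Proof. exact: measurable_coor. Qed.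

Lemma measurable_rbox n (a b : 'rV[R]_n) : measurable (rbox a b).
Proof.
rewrite (_ : rbox a b = \bigcap_(i in [set: 'I_n])
    ((fun x : 'rV[R]_n => x ord0 i) @^-1` `[a ord0 i, b ord0 i])).
  apply: fin_bigcap_measurable => // i _.
  by rewrite -[X in measurable X]setTI; apply: measurable_coordR.
by apply/seteqP; split=> [x xab i _|x xab i]; [|have := xab i I];
  rewrite /= in_itv/=.
Qed.

Lemma rboxI n (a b c d : 'rV[R]_n) :
  rbox a b `&` rbox c d =
  rbox (\row_i Num.max (a ord0 i) (c ord0 i))
       (\row_i Num.min (b ord0 i) (d ord0 i)).
Proof.
apply/seteqP; split=> [x [h1 h2] i|x h].
  rewrite !mxE ge_max le_min.
  by have /andP[-> ->] := h1 i; have /andP[-> ->] := h2 i.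
split=> i; have := h i; rewrite !mxE ge_max le_min;
  by case/andP=> /andP[h1 h2] /andP[h3 h4]; apply/andP.
Qed.

Definition rboxes n : set_system 'rV[R]_n :=
  [set A | exists a b, A = rbox a b].

Definition cube n (r : R) : set ('rV[R]_n) :=
  rbox (const_mx (- r)) (const_mx r).

Lemma bigcup_cube n : \bigcup_k @cube n k%:R = setT.
Proof.
apply/seteqP; split=> // x _.
exists (Num.bound (\sum_i `|x ord0 i|)) => // i.
rewrite !mxE -ler_norml.
have -> : `|x ord0 i| = \sum_(j | j == i) `|x ord0 j| by rewrite big_pred1_eq.
rewrite (le_trans _ (ltW (archi_boundP (sumr_ge0 _ _))))//.
by rewrite big_mkcond/= ler_sum// => j _; case: ifP.
Qed.

(** A half-space is a countable union of boxes, so the boxes generate the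
    sigma-algebra of the coordinates. *)
Lemma measurable_rboxesE n :
  measurable = <<s @rboxes n >> :> set_system 'rV[R]_n.
Proof.
apply/seteqP; split; last first.
  apply: smallest_sub; first exact: sigma_algebra_measurable.
  by move=> _ [a [b ->]]; exact: measurable_rbox.
apply: smallest_sub; first exact: smallest_sigma_algebra.
move=> A; rewrite -bigcup_seq/= => -[i _] [B mB <-]; rewrite setTI.
pose T' := g_sigma_algebraType (@rboxes n).
suff : measurable_fun [set: T'] (fun x : T' => (x : 'rV[R]_n) ord0 i).
  by move=> /(_ measurableT _ mB); rewrite setTI.
apply: (measurability (@RGenCInfty.G R)); first exact: RGenCInfty.measurableE.
move=> /= _ [_ [c ->] <-]; rewrite setTI.
rewrite (_ : _ @^-1` _ = \bigcup_k rbox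
   (\row_j if j == i then c else - k%:R) (const_mx k%:R)).
  apply: bigcupT_measurable => k.
  by apply: sub_sigma_algebra; eexists; eexists.
apply/seteqP; split=> x /=; rewrite in_itv/= andbT.
  move=> cx; have [] : (\bigcup_k @cube n k%:R) x by rewrite bigcup_cube.
  move=> k _ kx; exists k => // j; rewrite !mxE.
  by have := kx j; rewrite !mxE; case: eqP => [-> /andP[_ ->]|//]; rewrite cx.
by move=> [k _ /(_ i)]; rewrite mxE eqxx => /andP[].
Qed.

(** Boxes are stable under intersection and the cubes exhaust the space, so the
    uniqueness theorem for sigma-finite measures applies to them. *)
Lemma measure_unique_rboxes n (m1 m2 : {measure set 'rV[R]_n -> \bar R}) :
  (forall a b, m1 (rbox a b) = m2 (rbox a b)) ->
  (forall a b, (m1 (rbox a b) < +oo)%E) ->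
  forall A, measurable A -> m1 A = m2 A.
Proof.
move=> m12 m1oo; apply: (measure_unique (@rboxes n) (fun k => @cube n k%:R)).
- exact: measurable_rboxesE.
- by move=> _ _ [a [b ->]] [c [d ->]]; rewrite rboxI; eexists; eexists.
- by move=> i; eexists; eexists.
- exact: bigcup_cube.
- by move=> _ [a [b ->]].
- by move=> k; exact: m1oo.
Qed.

Lemma lebesgue_rbox n (a b : 'rV[R]_n) :
  lebesgue_rV R n (rbox a b) =
  (\prod_i Num.max 0 (b ord0 i - a ord0 i))%:E.
Proof.
elim: n a b => [|n IHn] a b.
  rewrite big_ord0 /= diracE.
  by rewrite mem_set//= => -[].
rewrite /= /rV_step /pushforward.
rewrite (_ : _ @^-1` _ = `[a ord0 ord0, b ord0 ord0] `*`
    rbox (\row_j a ord0 (lift ord0 j)) (\row_j b ord0 (lift ord0 j))); last first.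
  apply/seteqP; split=> [[t x]/= h|[t x] [/= ht hx] i].
    split=> /=.
      by have := h ord0; rewrite mxE unlift_none/= in_itv.
    by move=> j; have := h (lift ord0 j); rewrite !mxE liftK.
  rewrite /rV_cons mxE; case: (unliftP ord0 i) => [j ->|->] /=.
    by have := hx j; rewrite !mxE.
  by rewrite in_itv/= in ht.
rewrite product_measure1E//=; last exact: measurable_rbox.
rewrite IHn big_ord_recl EFinM; congr (_ * _)%E.
  rewrite lebesgue_measure_itv/= lte_fin.
  case: ltP => h; first by rewrite max_r// subr_ge0 ltW.
  by rewrite max_l// subr_le0.
by congr EFin; apply: eq_bigr => i _; rewrite !mxE.
Qed.

Lemma lebesgue_rbox_lty n (a b : 'rV[R]_n) :
  (lebesgue_rV R n (rbox a b) < +oo)%E.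
Proof. by rewrite lebesgue_rbox ltry. Qed.

(** Countably many boxes suffice: those with a rational centre and a half-side
    1 / (k + 1). *)
Lemma open_bigcup_rbox n (U : set 'rV[R]_n) : open U ->
  exists2 F : (set 'rV[R]_n)^nat,
    forall k, F k = set0 \/ exists a b, F k = rbox a b & \bigcup_k F k = U.
Proof.
move=> oU.
pose K (p : 'rV[rat]_n * nat) : set 'rV[R]_n :=
  rbox (\row_i (ratr (p.1 ord0 i) - p.2.+1%:R^-1))
       (\row_i (ratr (p.1 ord0 i) + p.2.+1%:R^-1)).
exists (fun k => if unpickle k is Some p
  then if `[< K p `<=` U >] then K p else set0 else set0).
  move=> k; case: unpickle => [p|]; last by left.
  by case: asboolP => _; [right; eexists; eexists|left].
apply/seteqP; split=> [x [k _]|x Ux].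
  by case: unpickle => // p; case: asboolP => // + Kx; exact.
have /nbhs_ballP[e /= e0 xeU] : nbhs x U by move: oU; rewrite openE; exact.
have e20 : 0 < e / 2 by rewrite divr_gt0.
have [k] := ltr_add_invr e20; rewrite add0r => ke.
have qP i : {q : rat | `|x ord0 i - ratr q| < k.+1%:R^-1}.
  apply: cid.
  have : x ord0 i - k.+1%:R^-1 < x ord0 i + k.+1%:R^-1.
    by rewrite ltrD2l gtrN// invr_gt0.
  move/rat_in_itvoo => [q]; rewrite in_itv/= => /andP[h1 h2].
  by exists q; rewrite distrC ltr_distl h1.
pose p : 'rV[rat]_n * nat := (\row_i sval (qP i), k).
exists (pickle p) => //; rewrite pickleK.
have KU : K p `<=` U.
  move=> y Ky; apply: xeU; split=> // i j.
  rewrite (ord1 i) /ball/=.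
  have := Ky j; rewrite !mxE/=; have := svalP (qP j).
  move: (ratr _ : R) => q h1 /andP[h2 h3].
  have h4 : `|q - y ord0 j| <= k.+1%:R^-1 by rewrite distrC ler_distl h2.
  rewrite -(subrK q (x ord0 j)) -addrA (le_lt_trans (ler_normD _ _))//.
  have -> : e = e / 2 + e / 2 by lra.
  by rewrite ltrD// ?(lt_trans h1)// (le_lt_trans h4).
case: asboolP => // _ i; rewrite !mxE/=.
have := svalP (qP i); move: (ratr _ : R) => q.
by rewrite ltr_distl => /andP[h1 h2]; rewrite !ltW.
Qed.

Lemma measurable_openrV n (U : set 'rV[R]_n) : open U -> measurable U.
Proof.
move=> /open_bigcup_rbox[F FE <-]; apply: bigcupT_measurable => k.
by have [->|[a [b ->]]] := FE k; [exact: measurable0|exact: measurable_rbox].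
Qed.

Lemma measurable_continuousrV n (f : 'rV[R]_n -> R) :
  continuous f -> measurable_fun setT f.
Proof.
move=> /continuousP cf.
apply: (measurability _ (RGenOpens.measurableE R)).
move=> _ [_ [a [b ->] <-]]; rewrite setTI.
by apply: measurable_openrV; apply: cf; exact: interval_open.
Qed.

Lemma measurable_shift n (h : 'rV[R]_n) :
  measurable_fun [set: 'rV[R]_n] (fun x => x + h).
Proof.
apply: measurable_fun_rV => i; under eq_fun do rewrite mxE.
by apply: measurable_funD => //; exact: measurable_coordR.
Qed.

(** A translate of a box is a box with the same side lengths. *)
Lemma lebesgue_shift n (h : 'rV[R]_n) (A : set 'rV[R]_n) : measurable A ->
  pushforward (lebesgue_rV R n) (fun x => x + h) A = lebesgue_rV R n A.
Proof.
move: A; apply: (@measure_unique_rboxes n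
  (measure_function_pushforward__canonical__measure_function_Measure
    (lebesgue_rV R n) (measurable_shift h))
  (lebesgue_rV R n)) => a b; rewrite /= /pushforward;
  rewrite (_ : _ @^-1` _ = rbox (a - h) (b - h)) ?lebesgue_rbox_lty//;
  try by apply/seteqP; split=> x H i; have := H i;
    rewrite !mxE lerBlDr lerBrDr.
rewrite !lebesgue_rbox; congr EFin; apply: eq_bigr => i _.
by rewrite !mxE; congr (Num.max _ _); ring.
Qed.

Lemma ge0_integral_shift n (h : 'rV[R]_n) (f : 'rV[R]_n -> \bar R) :
  measurable_fun setT f -> (forall x, 0 <= f x)%E ->
  (\int[lebesgue_rV R n]_x f (x + h)%R = \int[lebesgue_rV R n]_x f x)%E.
Proof.
move=> mf f0.
rewrite [RHS](eq_measure_integral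
  (measure_function_pushforward__canonical__measure_function_Measure
    (lebesgue_rV R n) (measurable_shift h))).
  rewrite ge0_integral_pushforward//; exact: measurable_shift.
by move=> A mA _; apply/esym/lebesgue_shift.
Qed.

Lemma integrable_shift n (h : 'rV[R]_n) (f : 'rV[R]_n -> \bar R) :
  (lebesgue_rV R n).-integrable setT f ->
  (lebesgue_rV R n).-integrable setT (fun x => f (x + h)).
Proof.
move=> /integrableP[mf foo]; apply/integrableP; split.
  by apply: measurableT_comp => //; exact: measurable_shift.
rewrite (ge0_integral_shift h (f := fun x => `|f x|%E))//.
exact: measurableT_comp.
Qed.

Lemma integral_shift n (h : 'rV[R]_n) (f : 'rV[R]_n -> \bar R) :
  (lebesgue_rV R n).-integrable setT f ->
  (\int[lebesgue_rV R n]_x f (x + h)%R = \int[lebesgue_rV R n]_x f x)%E.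
Proof.
move=> fi; have [mf _] := integrableP _ _ _ fi.
rewrite [RHS](eq_measure_integral
  (measure_function_pushforward__canonical__measure_function_Measure
    (lebesgue_rV R n) (measurable_shift h))).
  rewrite integral_pushforward//; first exact: measurable_shift.
  exact: integrable_shift.
by move=> A mA _; apply/esym/lebesgue_shift.
Qed.

Lemma lebesgue_rbox_gt0 n (a b : 'rV[R]_n) :
  (forall i, a ord0 i < b ord0 i) -> (0 < lebesgue_rV R n (rbox a b))%E.
Proof.
move=> ab; rewrite lebesgue_rbox lte_fin; apply: prodr_gt0 => i _.
by rewrite lt_max subr_gt0 ab orbT.
Qed.

Lemma bounded_sub_cube n (A : set 'rV[R]_n) : bounded_set A ->
  exists2 r : R, 0 < r & A `<=` @cube n r.
Proof.
move=> [M [_ AM]].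
exists (`|M| + 1); first by rewrite ltr_wpDl.
move=> x Ax i; have /(_ _ Ax) : forall x, A x -> `|x| <= `|M| + 1.
  by move=> y; apply: AM; rewrite (le_lt_trans (ler_norm _))// ltrDl.
rewrite !mxE -ler_norml => /(le_trans _); apply.
rewrite [leRHS]/Num.norm /= mx_normrE.
by apply/bigmax_geP; right; exists (ord0, i).
Qed.

Lemma open_lebesgue_gt0 n (U : set 'rV[R]_n) : open U -> U !=set0 ->
  (0 < lebesgue_rV R n U)%E.
Proof.
move=> oU [x Ux].
have /nbhs_ballP[e /= e0 xeU] : nbhs x U by move: oU; rewrite openE; exact.
apply: (@lt_le_trans _ _ (lebesgue_rV R n
    (rbox (\row_i (x ord0 i - e / 2)) (\row_i (x ord0 i + e / 2))))).
  by apply: lebesgue_rbox_gt0 => i; rewrite !mxE; lra.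
apply: le_measure; rewrite ?inE; [exact: measurable_rbox|exact: measurable_openrV|].
move=> y yx; apply: xeU; split=> // i j; rewrite (ord1 i) /ball/=.
have := yx j; rewrite !mxE => /andP[h1 h2].
by rewrite ltr_norml; apply/andP; split; lra.
Qed.

Lemma bounded_lebesgue_lty n (U : set 'rV[R]_n) : measurable U -> bounded_set U ->
  (lebesgue_rV R n U < +oo)%E.
Proof.
move=> mU /bounded_sub_cube[r r0 Ur].
apply: (@le_lt_trans _ _ (lebesgue_rV R n (@cube n r))).
  by apply: le_measure; rewrite ?inE//; exact: measurable_rbox.
exact: lebesgue_rbox_lty.
Qed.

End boxes.

(** * Smooth functions as products over the coordinates *)

Section flat.
Context (R : realType).
Implicit Types (k : nat) (s x : R).

(** For k = 0 this is the classical function that is flat at 0; the factor x^-k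
    makes the family stable under differentiation, up to linear combinations. *)
Definition flat k s x : R := if 0 < x then x^-1 ^+ k * expR (- s / x) else 0.

Lemma flat_le0 k s x : x <= 0 -> flat k s x = 0.
Proof. by rewrite /flat; case: ltP. Qed.

Lemma flat_ge0 k s x : 0 <= flat k s x.
Proof.
rewrite /flat; case: ltP => // x0.
by rewrite mulr_ge0 ?expR_ge0// exprn_ge0// invr_ge0 ltW.
Qed.

(** This makes every flat function differentiable at 0 with derivative 0: the
    difference quotient of [flat k s] is [flat k.+1 s]. *)
Lemma flat_linear_bound k s : 0 < s ->
  exists2 C, 0 <= C & forall x, flat k s x <= C * `|x|.
Proof.
move=> s0; exists ((k.+1%:R / s) ^+ k.+1).
  by rewrite exprn_ge0// divr_ge0// ltW.
move=> x; rewrite /flat; case: ltP => x0; last first.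
  by rewrite mulr_ge0// exprn_ge0// divr_ge0// ltW.
have -> : - s / x = - (s / x / k.+1%:R * k.+1%:R).
  have : k.+1%:R != 0 :> R by rewrite pnatr_eq0.
  by move: (k.+1%:R : R) => m m0; field; rewrite m0 gt_eqF.
rewrite expRN expRM_natr exprVn -invfM.
rewrite -(invrK (_ / s)) invf_div exprVn gtr0_norm//.
have p0 : 0 < (s / k.+1%:R) ^+ k.+1 by rewrite exprn_gt0// divr_gt0.
have e0 : 0 < expR (s / x / k.+1%:R) ^+ k.+1 by rewrite exprn_gt0// expR_gt0.
rewrite [leRHS]mulrC ler_pdivlMr// [leLHS]mulrC ler_pdivrMr ?mulr_gt0 ?exprn_gt0//.
rewrite mulrA -exprS [leLHS](_ : _ = x ^+ k.+1 * (s / x / k.+1%:R) ^+ k.+1); last first.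
  rewrite -exprMn; congr (_ ^+ _); move: (k.+1%:R^-1 : R) => m.
  by field; rewrite gt_eqF.
apply: ler_pM => //; rewrite ?exprn_ge0 ?ltW// ?divr_gt0//.
rewrite ltrXn2r ?nnegrE ?divr_ge0 ?expR_ge0 ?(ltW x0) ?(ltW s0)//.
  by rewrite (lt_le_trans _ (expR_ge1Dx _))// ltrDr.
exact: expR_gt0.
Qed.

Lemma is_derive_flat k s x : 0 < s -> is_derive x (1 : R) (flat k s)
  (s * flat k.+2 s x - k%:R * flat k.+1 s x).
Proof.
move=> s0; have [x0|x0|->] := ltgtP x 0.
- rewrite !flat_le0 ?ltW// !mulr0 subrr.
  have H : is_derive x (1 : R) (cst (0 : R) : R -> R) 0 by exact: is_derive_cst.
  apply: near_eq_is_derive H.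
  near=> y; rewrite flat_le0//; apply: ltW; near: y; exact: lt_nbhsl.
- have H : is_derive x (1 : R) (fun y : R => y^-1 ^+ k * expR (- s * y^-1))
      (s * flat k.+2 s x - k%:R * flat k.+1 s x).
    have H1 : is_derive x (1 : R) (fun y : R => y^-1) (- x ^- 2 *: (1 : R)).
      by apply: (@is_deriveV _ id); rewrite gt_eqF.
    have H2 := is_deriveX k H1; rewrite exprfctE in H2.
    have H3 := is_deriveM (is_derive_cst (- s) x (1 : R)) H1.
    have H4 := is_derive1_comp (is_derive_expR _) H3.
    apply: (is_derive_eq (is_deriveM H2 H4)).
    rewrite /flat x0 /GRing.scale/=.
    have ki : k%:R * x^-1 ^+ k.-1 * - x ^- 2 = - k%:R * x^-1 ^+ k.+1.
      case: (k) => [|m]; first by rewrite !mul0r oppr0 mul0r.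
      by rewrite /= -exprVn mulrN mulNr -mulrA -exprD addn2.
    move: (expR _) ki => E ki.
    rewrite [X in _ + E * X](_ : _ = - k%:R * x^-1 ^+ k.+1); last first.
      by rewrite -ki; ring.
    rewrite -exprVn !(exprS _ k.+1) !(exprS _ k); move: (x^-1) (k%:R : R) (x^-1 ^+ k) => y c z.
    by rewrite expr2; ring.
  apply: near_eq_is_derive H.
  near=> y; rewrite /flat ifT//; near: y; exact: lt_nbhsr.
- rewrite !flat_le0// !mulr0 subrr.
  have [C C0 HC] := flat_linear_bound k.+1 s0.
  have lim0 : h^-1 *: ((flat k s \o shift 0) (h *: (1 : R)) - flat k s 0)
      @[h --> 0^'] --> (0 : R).
    apply/cvgr0Pnorm_le => /= e e0.
    near=> h.
    rewrite /= [flat k s 0]flat_le0// subr0 addr0 /GRing.scale/= mulr1.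
    have : flat k.+1 s h <= e.
      rewrite (le_trans (HC _))//.
      rewrite (@le_trans _ _ ((C + 1) * `|h|))// ?ler_wpM2r// ?lerDl//.
      rewrite mulrC -ler_pdivlMr ?ltr_wpDl//.
      near: h; apply: dnbhs0_le; rewrite divr_gt0// ltr_wpDl//.
    apply: le_trans; rewrite ger0_norm.
      rewrite /flat; case: ifP; rewrite ?mulr0// => h0.
      by rewrite mulrA exprS.
    rewrite /flat; case: ifP => h0; rewrite ?mulr0//.
    by rewrite !mulr_ge0 ?expR_ge0// ?exprn_ge0 ?invr_ge0// ltW.
  apply: DeriveDef; first by apply/cvg_ex; exists 0.
  exact: cvg_lim.
Unshelve. all: by end_near. Qed.

End flat.

(** A class of one-variable functions large enough to contain the bumps, the
    cutoffs and the waves, and presented inductively so that its closure under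
    differentiation, hence smoothness, is a single induction. *)
Inductive elementary (R : realType) : (R -> R) -> Prop :=
| elem_cst c : elementary (fun=> c)
| elem_id : elementary (fun x => x)
| elem_sin f : elementary f -> elementary (fun x => sin (f x))
| elem_cos f : elementary f -> elementary (fun x => cos (f x))
| elem_flat k s f : 0 < s -> elementary f -> elementary (fun x => flat k s (f x))
| elem_add f g : elementary f -> elementary g -> elementary (fun x => f x + g x)
| elem_mul f g : elementary f -> elementary g -> elementary (fun x => f x * g x).

Section elementary.
Context (R : realType).

Lemma elementary_derive (f : R -> R) : elementary f ->
  exists2 f', elementary f' & forall x : R, is_derive x (1 : R) f (f' x).
Proof.
elim=> {f} [c||f ef [f' ef' df]|f ef [f' ef' df]|k s f s0 ef [f' ef' df]|
  f g ef [f' ef' df] eg [g' eg' dg]|f g ef [f' ef' df] eg [g' eg' dg]].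
- by exists (fun=> 0) => [|x]; [exact: elem_cst|exact: is_derive_cst].
- by exists (fun=> 1) => [|x]; [exact: elem_cst|exact: is_derive_id].
- exists (fun x => cos (f x) * f' x); first by apply: elem_mul => //; exact: elem_cos.
  by move=> x; apply: (is_derive1_comp (f := sin)).
- exists (fun x => (-1 * sin (f x)) * f' x).
    by do ![apply: elem_mul => //]; [exact: elem_cst|exact: elem_sin].
  move=> x; apply: (is_derive1_comp (f := cos)).
  by rewrite mulN1r; exact: is_derive_cos.
- exists (fun x => (s * flat k.+2 s (f x) + (- k%:R) * flat k.+1 s (f x)) * f' x).
    by do ?[exact: elem_cst|exact: elem_flat|assumption|apply: elem_mul|apply: elem_add].
  move=> x; apply: (is_derive1_comp (f := flat k s)).
  by rewrite mulNr; exact: is_derive_flat.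
- exists (fun x => f' x + g' x); first exact: elem_add.
  by move=> x; exact: is_deriveD.
- exists (fun x => f x * g' x + g x * f' x).
    by apply: elem_add; exact: elem_mul.
  by move=> x; exact: is_deriveM.
Qed.

Lemma elementary_derivable (f : R -> R) x : elementary f -> derivable f x 1.
Proof. by case/elementary_derive => f' _ /(_ x)[]. Qed.

Lemma elementary_derive1 (f : R -> R) : elementary f -> elementary f^`()%classic.
Proof.
case/elementary_derive => f' ef' df; suff -> : f^`()%classic = f' by [].
by apply/funext => x; rewrite derive1E; case: (df x).
Qed.

End elementary.

Section tensor.
Context (R : realType) (d : nat).
Implicit Types f : 'I_d -> R -> R.

Definition tensor f (x : 'rV[R]_d) : R := \prod_i f i (x ord0 i).

Lemma differentiable_tensor f x :
  (forall i t, derivable (f i) t 1) -> differentiable (tensor f) x.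
Proof.
move=> df; rewrite /tensor.
elim: (index_enum _) => [|i s IHs].
  by under eq_fun do rewrite big_nil; exact: differentiable_cst.
under eq_fun do rewrite big_cons.
apply: differentiableM => //.
apply: (@differentiable_comp _ _ _ _ (fun N : 'rV[R]_d => N ord0 i) (f i)).
  exact: differentiable_coord.
by apply/derivable1_diffP.
Qed.

Lemma partial_tensor f i : (forall j t, derivable (f j) t 1) ->
  partial i (tensor f) = tensor (fun j => if j == i then (f i)^`()%classic else f j).
Proof.
move=> df; apply/funext => x.
pose c := \prod_(j | j != i) f j (x ord0 j).
have tE h : tensor f (h *: delta_mx ord0 i + x) = f i (h + x ord0 i) * c.
  rewrite /tensor (bigD1 i)//= !mxE !eqxx mulr1; congr (_ * _).
  by apply: eq_bigr => j ji; rewrite !mxE eqxx (negbTE ji) mulr0 add0r.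
rewrite [RHS]/tensor (bigD1 i)//= eqxx.
rewrite [X in _ = _ * X](_ : _ = c); last by apply: eq_bigr => j /negbTE ->.
rewrite derive1E.
have fc : 'D_1 (fun t => f i t * c) (x ord0 i) = 'D_1 (f i) (x ord0 i) * c.
  by rewrite deriveMr// mulrC.
rewrite -fc /partial /derive.
apply: (congr1 (fun g : R -> R => lim (g h @[h --> 0^']))); apply/funext => h /=.
by rewrite tE /GRing.scale/= mulr1 -{2}(add0r x) -[0 in LHS](scale0r (delta_mx ord0 i)) tE add0r.
Qed.

(** A partial derivative of a product over the coordinates differentiates one
    factor, so all iterated derivatives stay products of elementary functions. *)
Lemma smooth_tensor f : (forall i, elementary (f i)) -> smooth (tensor f).
Proof.
move=> ef s x.
suff [g eg ->] : exists2 g, (forall i, elementary (g i)) &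
    foldr (@partial R d) (tensor f) s = tensor g.
  by apply: differentiable_tensor => i t; exact: elementary_derivable.
elim: s => [|i s [g eg gE]]; first by exists f.
exists (fun j => if j == i then (g i)^`()%classic else g j).
  by move=> j; case: eqP => // _; exact: elementary_derive1.
by rewrite /= gE partial_tensor// => j t; exact: elementary_derivable.
Qed.

Lemma closed_rbox (a b : 'rV[R]_d) : closed (rbox a b).
Proof.
rewrite (_ : rbox a b = \bigcap_(i in [set: 'I_d])
    ((fun x : 'rV[R]_d => x ord0 i) @^-1` `[a ord0 i, b ord0 i])).
  apply: closed_bigI => i _; apply: preimage_closed => //; last exact: interval_closed.
  by move=> x _; exact: coord_continuous.
by apply/seteqP; split=> [x xab i _|x xab i]; [|have := xab i I];
  rewrite /= in_itv/=.
Qed.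

Lemma bounded_rbox (a b : 'rV[R]_d) : bounded_set (rbox a b).
Proof.
exists (\sum_i (`|a ord0 i| + `|b ord0 i|)); split; first exact: num_real.
move=> M MH x xab; rewrite /= (le_trans _ (ltW MH))//.
rewrite [leLHS]/Num.norm /= mx_normrE; apply/bigmax_leP; split.
  by apply: sumr_ge0 => i _; rewrite addr_ge0.
move=> [i j] _ /=; rewrite (ord1 i) (bigD1 j)//=.
rewrite ler_wpDr//; first by apply: sumr_ge0 => k _; rewrite addr_ge0.
have /andP[h1 h2] := xab j; rewrite ler_norml.
have := ler_norm (b ord0 j); have := ler_norm (- a ord0 j); rewrite normrN.
have := normr_ge0 (a ord0 j); have := normr_ge0 (b ord0 j).
by move=> *; apply/andP; split; lra.
Qed.

Lemma compact_rbox (a b : 'rV[R]_d) : compact (rbox a b).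
Proof. by apply: bounded_closed_compact; [exact: bounded_rbox|exact: closed_rbox]. Qed.

Lemma test_function_tensor f (a b : 'rV[R]_d) (Omega : set 'rV[R]_d) :
  (forall i, elementary (f i)) ->
  (forall i t, f i t != 0 -> a ord0 i <= t <= b ord0 i) ->
  rbox a b `<=` Omega -> test_function Omega (tensor f).
Proof.
move=> ef fab abO.
have supp : closure [set x | tensor f x != 0] `<=` rbox a b.
  rewrite (closure_id (rbox a b)).1; last exact: closed_rbox.
  apply: closure_subset => x /= fx i; apply: fab; apply: contra fx => /eqP fi0.
  by rewrite /tensor (bigD1 i)//= fi0 mul0r.
split; first exact: smooth_tensor.
  by apply: subclosed_compact supp; [exact: closed_closure|exact: compact_rbox].
exact: subset_trans supp abO.
Qed.

End tensor.

(** * The fundamental lemma of the calculus of variations *)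

Section bump.
Context (R : realType).
Implicit Types s a b t : R.

Lemma flat0_le1 s t : 0 < s -> flat 0 s t <= 1.
Proof.
move=> s0; rewrite /flat; case: ltP => // t0.
by rewrite expr0 mul1r -expR0 ler_expR mulNr oppr_le0 divr_ge0// ltW.
Qed.

Lemma cvg_flat0 t : 0 < t -> flat 0 n.+1%:R^-1 t @[n --> \oo] --> (1 : R).
Proof.
move=> t0.
have -> : (fun n => flat 0 n.+1%:R^-1 t) = (fun n => expR (- t^-1 * n.+1%:R^-1)).
  by apply/funext => n; rewrite /flat t0 expr0 mul1r; congr expR; rewrite mulNr mulNr mulrC.
rewrite -[X in _ --> X]expR0; apply: continuous_cvg; first exact: continuous_expR.
rewrite -[X in _ --> X](mulr0 (- t^-1)).
apply: cvgMr; exact: (@cvg_harmonic R).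
Qed.

Definition bump s a b t : R := flat 0 s (t - a) * flat 0 s (b - t).

Lemma elementary_bump s a b : 0 < s -> elementary (bump s a b).
Proof.
move=> s0; rewrite /bump; apply: elem_mul.
  by apply: elem_flat => //; apply: elem_add; [exact: elem_id|exact: elem_cst].
apply: elem_flat => //; under eq_fun do rewrite -mulN1r.
by apply: elem_add; [exact: elem_cst|apply: elem_mul; [exact: elem_cst|exact: elem_id]].
Qed.

Lemma bump_ge0 s a b t : 0 <= bump s a b t.
Proof. by rewrite mulr_ge0// flat_ge0. Qed.

Lemma bump_le1 s a b t : 0 < s -> bump s a b t <= 1.
Proof. by move=> s0; rewrite mulr_ile1 ?flat_ge0 ?flat0_le1. Qed.

Lemma bump_eq0 s a b t : ~~ (a < t < b) -> bump s a b t = 0.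
Proof.
by rewrite negb_and -!leNgt => /orP[ta|bt]; rewrite /bump;
  [rewrite (flat_le0 _ _ (x := t - a)) ?mul0r|rewrite (flat_le0 _ _ (x := b - t)) ?mulr0];
  rewrite // subr_le0.
Qed.

Lemma cvg_bump a b t : a < t < b -> bump n.+1%:R^-1 a b t @[n --> \oo] --> (1 : R).
Proof.
move=> /andP[ta bt]; rewrite -[X in _ --> X](mulr1 1).
by apply: cvgM; apply: cvg_flat0; rewrite subr_gt0.
Qed.

End bump.

Section fundamental_lemma.
Context (R : realType) (n : nat).
Local Notation leb := (lebesgue_rV R n).
Implicit Types (a b : 'rV[R]_n) (w : 'rV[R]_n -> R).

Definition boxbump s a b : 'rV[R]_n -> R :=
  tensor (fun i => bump s (a ord0 i) (b ord0 i)).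

Lemma boxbump_norm_le1 s a b x : 0 < s -> `|boxbump s a b x| <= 1.
Proof.
move=> s0; rewrite /boxbump /tensor normr_prod.
apply: (@le_trans _ _ (\prod_(i < n) 1)); last by rewrite big1.
by apply: ler_prod => i _; rewrite normr_ge0 ger0_norm ?bump_ge0// bump_le1.
Qed.

Lemma continuous_smooth (phi : 'rV[R]_n -> R) : smooth phi -> continuous phi.
Proof. by move=> sphi x; apply: differentiable_continuous; exact: (sphi [::]). Qed.

Lemma measurable_boxbump s a b : 0 < s -> measurable_fun setT (boxbump s a b).
Proof.
move=> s0; apply: measurable_continuousrV; apply: continuous_smooth.
by apply: smooth_tensor => i; exact: elementary_bump.
Qed.

Lemma boxbump_eq0 s a b x : ~ rbox a b x -> boxbump s a b x = 0.
Proof.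
move=> /existsNP[i xi]; rewrite /boxbump /tensor (bigD1 i)//= bump_eq0 ?mul0r//.
by apply/negP => /andP[h1 h2]; apply: xi; rewrite !ltW.
Qed.

Lemma test_function_boxbump s a b (Omega : set 'rV[R]_n) : 0 < s ->
  rbox a b `<=` Omega -> test_function Omega (boxbump s a b).
Proof.
move=> s0; apply: test_function_tensor => i; first exact: elementary_bump.
by move=> t; apply: contraR => h; apply/eqP; apply: bump_eq0; apply: contra h => /andP[h1 h2];
  rewrite !ltW.
Qed.

Lemma cvg_boxbump a b (x : 'rV[R]_n) : (forall i, a ord0 i < x ord0 i < b ord0 i) ->
  boxbump m.+1%:R^-1 a b x @[m --> \oo] --> (1 : R).
Proof.
move=> xab; rewrite /boxbump /tensor.
rewrite [X in _ --> X](_ : _ = \prod_(i < n) 1); last by rewrite big1.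
elim: (index_enum _) => [|i s IHs].
  by under eq_fun do rewrite big_nil; rewrite big_nil; exact: cvg_cst.
under eq_fun do rewrite big_cons; rewrite big_cons.
by apply: cvgM => //; exact: cvg_bump.
Qed.

(** A hyperplane is a countable union of boxes with one vanishing side.  This
    discards the faces of a box, on which the bumps do not converge to 1. *)
Lemma ae_coord_neq (i : 'I_n) (c : R) : {ae leb, forall x : 'rV[R]_n, x ord0 i <> c}.
Proof.
apply: (@negligibleS _ _ _ leb (\bigcup_k rbox
   (\row_j if j == i then c else - k%:R) (\row_j if j == i then c else k%:R))).
  move=> x /= /contrapT xc.
  have [] : (\bigcup_k @cube R n k%:R) x by rewrite bigcup_cube.
  move=> k _ kx; exists k => // j; rewrite !mxE.
  by have := kx j; rewrite !mxE; case: eqP => [->|//]; rewrite xc lexx.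
apply: negligible_bigcup => k; apply/negligibleP; first exact: measurable_rbox.
by apply: etrans (lebesgue_rbox _ _) _; rewrite (bigD1 i)//= !mxE eqxx subrr maxxx mul0r.
Qed.

(** As s tends to 0 the bumps increase to the indicator of the open box, and
    dominated convergence applies. *)
Lemma integral_rbox_bump w a b : leb.-integrable setT (EFin \o w) ->
  (forall s : R, (0 < s)%R -> \int[leb]_x (w x * boxbump s a b x)%R%:E = 0)%E ->
  (\int[leb]_(x in rbox a b) (w x)%:E = 0)%E.
Proof.
move=> wi w0.
have mw : measurable_fun setT w by apply/measurable_EFinP; exact: measurable_int wi.
have s0 m : 0 < m.+1%:R^-1 :> R by [].
have [|||||_ _] := @dominated_convergence _ _ _ leb setT measurableT
  (fun m x => (w x * boxbump m.+1%:R^-1 a b x)%R%:E)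
  ((EFin \o w) \_ (rbox a b)) (fun x => `|(w x)%:E|%E).
- by move=> m; apply/measurable_EFinP/measurable_funM => //; exact: measurable_boxbump.
- apply: (measurable_restrictT _ _).1; first exact: measurable_rbox.
  by apply: measurable_funTS; apply/measurable_EFinP.
- have H : {ae leb, forall x : 'rV[R]_n, forall i : 'I_n,
      x ord0 i <> a ord0 i /\ x ord0 i <> b ord0 i}.
    apply: filter_forall => i.
    by apply: filterS2 (ae_coord_neq i (a ord0 i)) (ae_coord_neq i (b ord0 i)).
  apply: filterS H => x xab _; rewrite patchE; case: ifPn => [|]; rewrite ?inE ?notin_setE => xr.
    apply: cvg_EFin; first by near=> m.
    rewrite -[X in _ --> X]mulr1; apply: cvgMr; apply: cvg_boxbump => i.
    have /andP[h1 h2] := xr i; have [/eqP h3 /eqP h4] := xab i.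
    by rewrite !lt_neqAle h1 h2 h4 eq_sym h3.
  under eq_fun do rewrite boxbump_eq0// mulr0.
  exact: cvg_cst.
- exact: integrable_abse.
- apply: aeW => x m _; rewrite abse_EFin lee_fin normrM ler_piMr//.
  exact: boxbump_norm_le1.
under eq_fun do rewrite w0//.
by rewrite -integral_mkcond => /cvg_lim <-//; rewrite lim_cst.
Unshelve. all: by end_near. Qed.

(** The sets on which w has integral 0 form a Dynkin system; it contains the
    boxes, hence all measurable subsets. *)
Lemma integral_rbox0_ae (w : 'rV[R]_n -> R) (p q : 'rV[R]_n) :
  leb.-integrable setT (EFin \o w) ->
  (forall a b, rbox a b `<=` rbox p q ->
    \int[leb]_(x in rbox a b) (w x)%:E = 0)%E ->
  leb.-negligible (rbox p q `&` [set x | w x <> 0]).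
Proof.
move=> wi w0.
have mK : measurable (rbox p q) by exact: measurable_rbox.
have wiS A : measurable A -> leb.-integrable A (EFin \o w).
  by move=> mA; apply: integrableS wi.
have wK0 : forall A, measurable A -> (\int[leb]_(x in A `&` rbox p q) (w x)%:E = 0)%E.
  rewrite {1}measurable_rboxesE; apply: dynkin_induction.
  - exact: measurable_rboxesE.
  - by move=> _ _ [a [b ->]] [c [d ->]]; rewrite rboxI; eexists; eexists.
  - by rewrite setTI; exact: w0.
  - move=> _ [a [b ->]]; rewrite rboxI; apply: w0.
    by rewrite -rboxI; exact: subIsetr.
  - move=> S mS S0; have := w0 _ _ (@subset_refl _ (rbox p q)).
    rewrite -{1}(setIT (rbox p q)) -(setUv S) setIUr integral_setU//.
    + by rewrite setIC S0 add0e setIC.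
    + exact: measurableI.
    + by apply: measurableI => //; exact: measurableC.
    + apply: measurable_int (wiS _ _).
      by apply: measurableU; apply: measurableI => //; exact: measurableC.
    + by apply/disj_setPS; rewrite -setIIr setICr setI0.
  - move=> F mF tF F0; rewrite setI_bigcupl integral_bigcup.
    + by apply: eseries0 => k _ _; exact: F0.
    + exact: trivIset_setIr.
    + by move=> k; exact: measurableI.
    + apply: wiS; apply: bigcupT_measurable => k; exact: measurableI.
have /= [|||N [mN N0 KN]] := @integral_ae_eq _ _ _ leb _ mK (cst 0%E) (EFin \o w).
- exact: wiS.
- exact: measurable_cst.
- by move=> E EK mE; rewrite -(setIidl EK) wK0// integral0.
exists N; split=> // x [Kx wx]; apply: KN => /= h; apply: wx.
by have [] := h Kx.
Qed.

Lemma fundamental_lemma w (U : set 'rV[R]_n) : open U ->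
  leb.-integrable setT (EFin \o w) ->
  (forall a b (s : R), (0 < s)%R -> rbox a b `<=` U ->
    \int[leb]_x (w x * boxbump s a b x)%R%:E = 0)%E ->
  {ae leb, forall x, U x -> w x = 0}.
Proof.
move=> oU wi w0; have [F FE FU] := open_bigcup_rbox oU.
apply: (@negligibleS _ _ _ leb (\bigcup_k (F k `&` [set x | w x <> 0]))).
  move=> x /= /not_implyP[]; rewrite -FU => -[k _ Fkx] wx.
  by exists k.
apply: negligible_bigcup => k.
have FkU : F k `<=` U by rewrite -FU; exact: bigcup_sup.
have [->|[p [q FkE]]] := FE k; first by rewrite set0I; exact: negligible_set0.
rewrite FkE; apply: integral_rbox0_ae => // a b abK.
apply: integral_rbox_bump => // s s0; apply: w0 => //.
by apply: subset_trans FkU; rewrite FkE.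
Qed.

End fundamental_lemma.

(** * Integration along segments *)

Section integration.
Context d (T : measurableType d) (R : realType) (mu : {measure set T -> \bar R}).
Implicit Types (D : set T) (f g : T -> R).

Lemma integrable_mul_bounded D f g (C : R) : measurable D ->
  mu.-integrable D (EFin \o f) -> measurable_fun D g ->
  (forall x, D x -> `|g x| <= C) -> mu.-integrable D (fun x => (f x * g x)%:E).
Proof.
move=> mD fi mg gC; have mf : measurable_fun D f.
  by apply/measurable_EFinP; exact: measurable_int fi.
apply: (le_integrable mD (g := fun x => (`|C|%:E * `|(f x)%:E|)%E)).
- by apply/measurable_EFinP; exact: measurable_funM.
- move=> x Dx; rewrite abse_EFin normrM -EFinM abse_EFin lee_fin.
  rewrite normrM !normr_id mulrC ler_wpM2r//.
  exact: le_trans (gC x Dx) (ler_norm _).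
- by apply: integrableZl => //; exact: integrable_abse.
Qed.

Lemma integrable_sq D f : measurable D -> (mu D < +oo)%E -> measurable_fun D f ->
  mu.-integrable D (fun x => (f x ^+ 2)%:E) -> mu.-integrable D (EFin \o f).
Proof.
move=> mD Doo mf f2.
apply: (le_integrable mD (g := fun x => (cst 1%:E x + (f x ^+ 2)%:E)%E)).
- exact/measurable_EFinP.
- move=> x _ /=; rewrite lee_fin; apply: le_trans (ler_norm _).
  have : `|f x| ^+ 2 = f x ^+ 2 by rewrite -normrX ger0_norm// sqr_ge0.
  by have := sqr_ge0 (`|f x| - 1); rewrite sqrrB1; have := sqr_ge0 `|f x|; lra.
- apply: integrableD => //; apply/integrableP; split; first exact: measurable_cst.
  under eq_integral do rewrite /= normr1.
  by rewrite (@integral_cst _ _ _ mu D mD 1%E) mul1e.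
Qed.

End integration.

Section fubini01.
Context (R : realType) (n : nat).
Local Notation leb := (lebesgue_rV R n).
Local Notation lam := (@lebesgue_measure R).
Local Notation I01 := (`[0%R, 1%R]%classic : set (measurableTypeR R)).
Variable f : 'rV[R]_n * measurableTypeR R -> R.
Hypothesis mf : measurable_fun setT f.
Hypothesis foo : (\int[lam]_(t in I01) \int[leb]_x `|f (x, t)|%:E < +oo)%E.

Let F (p : 'rV[R]_n * measurableTypeR R) : \bar R := (f p * \1_I01 p.2)%:E.

Let mF : measurable_fun setT F.
Proof.
apply/measurable_EFinP; apply: measurable_funM => //.
by apply: measurableT_comp; [exact: measurable_indic|exact: measurable_snd].
Qed.

Let restrF (g : R -> R) : (fun t => (g t * \1_I01 t)%:E) = (fun t => (g t)%:E) \_ I01.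
Proof.
apply/funext => t; rewrite patchE indicE; by case: ifP; rewrite ?mulr1 ?mulr0.
Qed.

Let iF : (leb \x lam)%E.-integrable setT F.
Proof.
apply/integrable21ltyP; first exact: mF.
apply: le_lt_trans foo; rewrite le_eqVlt; apply/orP; left; apply/eqP.
rewrite [RHS]integral_mkcond; apply: eq_integral => t _; rewrite patchE.
rewrite /F/= indicE; case: ifP => _.
  by apply: eq_integral => x _; rewrite mulr1.
by rewrite integral0_eq// => x _; rewrite mulr0 normr0.
Qed.

Definition int01 (x : 'rV[R]_n) : R := \int[lam]_(t in I01) f (x, t).

Lemma ae_integrable01 :
  {ae leb, forall x, lam.-integrable I01 (fun t => (f (x, t))%:E)}.
Proof.
have := ae_integrable1 iF; apply: filterS => x; rewrite /F/=.
by rewrite (restrF (fun t => f (x, t))) -integrable_mkcond.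
Qed.

Let int01E : ae_eq leb setT (EFin \o int01) (fubini_F lam F).
Proof.
have := ae_integrable01; apply: filterS => x ix _.
rewrite /fubini_F /F /int01 /= (restrF (fun t => f (x, t))) -integral_mkcond.
by rewrite fineK//; exact: integrable_fin_num.
Qed.

Let measurable_int01 : measurable_fun setT int01.
Proof.
rewrite (_ : int01 = fine \o fubini_F lam F).
  apply: measurableT_comp => //.
  exact: measurable_fubini_F iF.
apply/funext => x.
by rewrite /fubini_F /F /int01 /Rintegral /= (restrF (fun t => f (x, t))) -integral_mkcond.
Qed.

Lemma integrable_int01 : leb.-integrable setT (EFin \o int01).
Proof.
apply/integrableP; split; first exact/measurable_EFinP.
have /integrableP[_] := integrable_fubini_F iF.
apply: le_lt_trans; rewrite (@ge0_ae_eq_integral _ _ _ leb setT _ (fun x => `|fubini_F lam F x|)%E)//.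
- by apply/measurable_EFinP; apply: measurableT_comp.
- by apply: measurableT_comp => //; exact: measurable_fubini_F iF.
- have := int01E; apply: filterS => x /(_ Logic.I) /= E _.
  by rewrite -E.
Qed.

(** Fubini for a product with the unit interval, deduced from the case of the
    whole line by inserting the indicator of the interval. *)
Lemma fubini01 :
  (\int[leb]_x (int01 x)%:E = \int[lam]_(t in I01) \int[leb]_x (f (x, t))%:E)%E.
Proof.
rewrite (@ae_eq_integral _ _ _ leb setT (fubini_F lam F) (EFin \o int01))//; last 2 first.
- exact/measurable_EFinP.
- exact: measurable_fubini_F iF.
rewrite /fubini_F (Fubini iF).
rewrite [RHS]integral_mkcond; apply: eq_integral => t _; rewrite patchE.
rewrite /F/= indicE; case: ifP => _.
  by apply: eq_integral => x _; rewrite mulr1.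
by rewrite integral0_eq// => x _; rewrite mulr0.
Qed.

End fubini01.

Section ftc.
Context (R : realType) (n : nat).
Local Notation lam := (@lebesgue_measure R).
Local Notation I01 := (`[0%R, 1%R]%classic : set (measurableTypeR R)).

Lemma ftc_segment (phi : 'rV[R]_n -> R) (h x : 'rV[R]_n) :
  (forall y, derivable phi y h) -> continuous ('D_h phi) ->
  (\int[lam]_(t in I01) ('D_h phi (x + t *: h))%:E = (phi (x + h) - phi x)%:E)%E.
Proof.
move=> dphi cphi.
pose F (t : R) := phi (x + t *: h).
have lineE t : (fun r : R => r^-1 *: (F (r *: (1 : R) + t) - F t)) =
    (fun r : R => r^-1 *: (phi (r *: h + (x + t *: h)) - phi (x + t *: h))).
  apply/funext => r; rewrite /F; congr (_ *: (phi _ - _)).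
  have -> : r *: (1 : R) = r by rewrite /GRing.scale/= mulr1.
  by rewrite scalerDl addrCA.
have dF t : derivable F t 1.
  by have := dphi (x + t *: h); rewrite /derivable /= lineE.
have F'E t : F^`()%classic t = 'D_h phi (x + t *: h).
  by rewrite derive1E /derive /= lineE.
have cF : continuous F.
  move=> t; apply: differentiable_continuous; exact/derivable1_diffP.
have cline : continuous (fun t : R => x + t *: h).
  move=> t; apply: cvgD; first exact: cvg_cst.
  by apply: cvgZr_tmp => //; exact: cvg_id.
rewrite (@continuous_FTC2 _ (fun t => 'D_h phi (x + t *: h)) F 0 1 ltr01).
- by rewrite /F scale1r scale0r addr0.
- apply: continuous_subspaceT => t.
  apply: (@continuous_comp _ _ _ (fun t : R => x + t *: h) ('D_h phi)).
    exact: cline.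
  exact: cphi.
- split=> [t _||]; first exact: dF.
    by apply: cvg_at_right_filter; exact: cF.
  by apply: cvg_at_left_filter; exact: cF.
- by move=> t _; exact: F'E.
Qed.

End ftc.

(** * Test functions, weak gradients and translations *)

Section test_functions.
Context (R : realType) (n : nat).
Implicit Types (phi : 'rV[R]_n -> R) (Omega : set 'rV[R]_n).

Lemma continuous_partial phi i : smooth phi -> continuous (partial i phi).
Proof. by move=> sphi x; apply: differentiable_continuous; exact: (sphi [:: i]). Qed.

Lemma derive_partial phi (h x : 'rV[R]_n) : differentiable phi x ->
  'D_h phi x = \sum_i h ord0 i * partial i phi x.
Proof.
move=> dphi; rewrite deriveE// [in LHS](row_sum_delta h) linear_sum.
by apply: eq_bigr => i _; rewrite linearZ /= /partial deriveE.
Qed.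

Lemma continuous_bounded (K : set 'rV[R]_n) phi : compact K -> continuous phi ->
  (forall x, ~ K x -> phi x = 0) -> exists C, forall x, `|phi x| <= C.
Proof.
move=> cK cphi phi0.
have [K0|/set0P K0] := eqVneq K set0.
  by exists 0 => x; rewrite phi0 ?normr0// K0.
have [|c _ Hc] := @EVT_max_rV R n (fun x => `|phi x|) K K0 cK.
  apply: continuous_subspaceT => x; apply: continuous_comp; first exact: cphi.
  exact: norm_continuous.
exists `|phi c| => x; have [Kx|nKx] := pselect (K x).
  by apply: Hc; rewrite inE.
by rewrite phi0// normr0.
Qed.

Lemma partial_support phi i x : ~ closure [set x | phi x != 0] x -> partial i phi x = 0.
Proof.
move=> nx; rewrite /partial -[RHS](derive_cst (0 : R) x (delta_mx ord0 i)).
apply: near_eq_derive.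
have : nbhs x (~` closure [set x | phi x != 0]).
  by apply: open_nbhs_nbhs; split=> //; rewrite openC; exact: closed_closure.
apply: filterS => y; apply: contra_notP => /eqP py.
exact: subset_closure.
Qed.

Lemma test_function_out Omega phi x : test_function Omega phi -> ~ Omega x ->
  phi x = 0 /\ forall i, partial i phi x = 0.
Proof.
move=> [sphi _ sO] nx.
have nc : ~ closure [set x | phi x != 0] x by move=> /sO.
split=> [|i]; last exact: partial_support.
by apply: contra_notP nc => /eqP py; exact: subset_closure.
Qed.

Lemma test_function_bounded Omega phi : test_function Omega phi ->
  exists C, forall x, `|phi x| <= C.
Proof.
move=> [sphi cphi _]; apply: (continuous_bounded cphi (continuous_smooth sphi)) => x.
by apply: contra_notP => /eqP py; exact: subset_closure.
Qed.

Lemma test_function_partial_bounded Omega phi i : test_function Omega phi ->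
  exists C, forall x, `|partial i phi x| <= C.
Proof.
move=> [sphi cphi _]; apply: (continuous_bounded cphi (continuous_partial sphi)) => x.
exact: partial_support.
Qed.

Lemma measurable_smooth phi : smooth phi -> measurable_fun setT phi.
Proof. by move=> /continuous_smooth; exact: measurable_continuousrV. Qed.

Lemma measurable_partial phi i : smooth phi -> measurable_fun setT (partial i phi).
Proof. by move=> /continuous_partial h; apply: measurable_continuousrV; exact: h. Qed.

Lemma derive_shift phi (h v x : 'rV[R]_n) :
  'D_h (fun y => phi (y + v)) x = 'D_h phi (x + v).
Proof.
rewrite /derive; apply: (congr1 (fun g : R -> R => lim (g h @[h --> 0^'])));
by apply/funext => r /=; rewrite addrA.
Qed.

End test_functions.

Section extension.
Context (R : realType) (n : nat) (Omega : set 'rV[R]_n).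
Local Notation leb := (lebesgue_rV R n).
Hypotheses (oO : open Omega) (bO : bounded_set Omega).

Let mO : measurable Omega := measurable_openrV oO.
Let Ooo : (leb Omega < +oo)%E := bounded_lebesgue_lty mO bO.

(** Extension by 0 turns integrals over Omega into integrals over the whole
    space, where translations act. *)
Definition ext (u : 'rV[R]_n -> R) (x : 'rV[R]_n) : R :=
  if x \in Omega then u x else 0.

Lemma ext_in u x : Omega x -> ext u x = u x.
Proof. by move=> Ox; rewrite /ext mem_set. Qed.

Lemma extM u v x : ext u x * v x = ext (fun y => u y * v y) x.
Proof. by rewrite /ext; case: ifP => //; rewrite mul0r. Qed.

Lemma integral_ext (f : 'rV[R]_n -> R) :
  (\int[leb]_(x in Omega) (f x)%:E = \int[leb]_x (ext f x)%:E)%E.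
Proof.
rewrite integral_mkcond; apply: eq_integral => x _.
by rewrite patchE /ext; case: ifP.
Qed.

Lemma integrable_ext (f : 'rV[R]_n -> R) :
  leb.-integrable Omega (EFin \o f) <-> leb.-integrable setT (EFin \o ext f).
Proof.
rewrite integrable_mkcond// (_ : (EFin \o f) \_ Omega = EFin \o ext f)//.
by apply/funext => x; rewrite patchE /ext /=; case: ifP.
Qed.

Lemma L2_integrable u : L2 Omega u -> leb.-integrable Omega (EFin \o u).
Proof. by move=> [mu u2]; exact: integrable_sq. Qed.

Lemma L2_ext_integrable u : L2 Omega u -> leb.-integrable setT (EFin \o ext u).
Proof. by move=> /L2_integrable/integrable_ext. Qed.

Lemma measurable_ext u : measurable_fun Omega u -> measurable_fun setT (ext u).
Proof.
by move=> mu; exact: (measurable_restrictT u mO).1 mu.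
Qed.

Lemma weak_gradient_ext u g i phi : H1 Omega u g -> test_function Omega phi ->
  (\int[leb]_x (ext u x * partial i phi x)%R%:E =
   - \int[leb]_x (ext (g i) x * phi x)%R%:E)%E.
Proof.
move=> [u2 g2 wg] tphi; have := wg i phi tphi; have [sphi _ _] := tphi.
have [C1 HC1] := test_function_bounded tphi.
have [C2 HC2] := test_function_partial_bounded i tphi.
have i1 : leb.-integrable setT (fun x => (ext u x * partial i phi x)%:E).
  apply: (integrable_mul_bounded (C := C2)) => //; first exact: L2_ext_integrable.
  exact: measurable_partial.
have i2 : leb.-integrable setT (fun x => (ext (g i) x * phi x)%:E).
  apply: (integrable_mul_bounded (C := C1)) => //; first exact: L2_ext_integrable.
  exact: measurable_smooth.
rewrite /Rintegral !integral_ext.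
under eq_integral do rewrite -extM.
under [in X in _ = X -> _]eq_integral do rewrite -extM.
move=> E; rewrite -(fineK (integrable_fin_num _ i1))// E EFinN fineK//.
exact: integrable_fin_num.
Qed.

Definition dir (g : 'I_n -> 'rV[R]_n -> R) (h x : 'rV[R]_n) : R :=
  \sum_i h ord0 i * ext (g i) x.

Lemma integrable_dir g h : (forall i, L2 Omega (g i)) ->
  leb.-integrable setT (EFin \o dir g h).
Proof.
move=> g2; rewrite (_ : _ \o _ = fun x => (\sum_i (h ord0 i * ext (g i) x)%R%:E)%E).
  apply: integrable_sum => // i _.
  under eq_fun do rewrite EFinM.
  by apply: integrableZl => //; exact: L2_ext_integrable.
by apply/funext => x; rewrite /dir /= sumEFin.
Qed.

(** The definition of the weak gradient, summed over the coordinates of h; the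
    sign of the integration by parts is absorbed in the direction - h. *)
Lemma weak_gradient_dir u g h phi : H1 Omega u g -> test_function Omega phi ->
  (\int[leb]_x (dir g h x * phi x)%R%:E = \int[leb]_x (ext u x * 'D_(- h) phi x)%R%:E)%E.
Proof.
move=> H tphi; have [u2 g2 wg] := H; have [sphi _ _] := tphi.
have [C1 HC1] := test_function_bounded tphi.
have i1 i : leb.-integrable setT (fun x => (ext u x * partial i phi x)%:E).
  have [C2 HC2] := test_function_partial_bounded i tphi.
  apply: (integrable_mul_bounded (C := C2)) => //; first exact: L2_ext_integrable.
  exact: measurable_partial.
have i2 i : leb.-integrable setT (fun x => (ext (g i) x * phi x)%:E).
  apply: (integrable_mul_bounded (C := C1)) => //; first exact: L2_ext_integrable.
  exact: measurable_smooth.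
transitivity (\sum_i (h ord0 i)%:E * \int[leb]_x (ext (g i) x * phi x)%R%:E)%E.
  rewrite (eq_integral (fun x => \sum_i (h ord0 i)%:E * (ext (g i) x * phi x)%:E)%E).
    rewrite integral_sum//; last by move=> i; exact: integrableZl.
    by apply: eq_bigr => i _; rewrite integralZl.
  by move=> x _; rewrite /dir mulr_suml -sumEFin; apply: eq_bigr => i _; rewrite -mulrA EFinM.
rewrite (eq_integral (fun x => \sum_i (- h ord0 i)%:E * (ext u x * partial i phi x)%:E)%E).
  rewrite integral_sum//; last by move=> i; exact: integrableZl.
  apply: eq_bigr => i _; rewrite integralZl// (weak_gradient_ext i H)//.
  by rewrite EFinN mulNe muleN oppeK.
move=> x _; rewrite derive_partial; last exact: (sphi [::]).
rewrite mulr_sumr -sumEFin; apply: eq_bigr => i _.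
by rewrite -EFinM mxE; congr EFin; ring.
Qed.

End extension.

Section translation.
Context (R : realType) (n : nat) (Omega : set 'rV[R]_n).
Local Notation leb := (lebesgue_rV R n).
Local Notation lam := (@lebesgue_measure R).
Local Notation I01 := (`[0%R, 1%R]%classic : set (measurableTypeR R)).
Hypotheses (oO : open Omega) (bO : bounded_set Omega).

Lemma measurable_segment (h : 'rV[R]_n) :
  measurable_fun setT (fun p : 'rV[R]_n * measurableTypeR R => p.1 + p.2 *: h).
Proof.
apply: measurable_fun_rV => i; under eq_fun do rewrite !mxE.
apply: measurable_funD.
  apply: (measurableT_comp (f := fun x : 'rV[R]_n => x ord0 i)).
    exact: measurable_coordR.
  exact: measurable_fst.
by apply: measurable_funM => //; exact: measurable_snd.
Qed.

Lemma integral_I01_cst (c : \bar R) : (\int[lam]_(t in I01) c = c)%E.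
Proof.
have mI : measurable I01 by exact: measurable_itv.
rewrite integral_cst//.
by rewrite [X in (_ * X)%E = _]lebesgue_measure_itv/= lte_fin ltr01 sube0 mule1.
Qed.

(** The bounding function is integrated along translates, which all have the
    same integral. *)
Lemma fubini01_dominated (f : 'rV[R]_n * measurableTypeR R -> R)
    (G : 'rV[R]_n -> R) (h : 'rV[R]_n) (C : R) :
  measurable_fun setT f -> leb.-integrable setT (EFin \o G) ->
  (forall x t, `|f (x, t)| <= C * `|G (x + t *: h)|) ->
  (\int[lam]_(t in I01) \int[leb]_x `|f (x, t)|%:E < +oo)%E.
Proof.
move=> mf Gi fG; have mG : measurable_fun setT G.
  by apply/measurable_EFinP; exact: measurable_int Gi.
have /integrableP[_ Goo] := Gi.
have C0 : (0 <= `|C|%:E)%E by rewrite lee_fin.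
pose K := (`|C|%:E * \int[leb]_x `|(G x)%:E|)%E.
have Koo : (K < +oo)%E by rewrite lte_mul_pinfty.
apply: le_lt_trans Koo; rewrite -(integral_I01_cst K).
apply: ge0_le_integral => //.
- by move=> t _; apply: integral_ge0.
- apply: measurable_funTS.
  apply: (@measurable_fun_fubini_tonelli_G _ _ _ _ _ leb (fun p => `|f p|%:E)) => //.
  by apply/measurable_EFinP; exact: measurableT_comp.
move=> t _; rewrite /K -ge0_integralZl//; last first.
  by apply: measurableT_comp => //; exact/measurable_EFinP.
rewrite -[leRHS](ge0_integral_shift (t *: h)); last 2 first.
- apply: measurable_funeM; apply: measurableT_comp => //; exact/measurable_EFinP.
- by move=> x; rewrite mule_ge0.
apply: ge0_le_integral => //.
- apply/measurable_EFinP; apply: measurableT_comp => //.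
  by apply: measurableT_comp mf _; exact: measurable_pair2.
- apply: measurable_funeM; apply: measurableT_comp => //; apply/measurable_EFinP.
  by apply: measurableT_comp => //; exact: measurable_shift.
move=> x _; rewrite abse_EFin -EFinM lee_fin (le_trans (fG x t))// ler_wpM2r//.
exact: ler_norm.
Qed.

Lemma test_function_derive phi (h : 'rV[R]_n) : test_function Omega phi ->
  continuous ('D_h phi) /\ exists C, forall x, `|'D_h phi x| <= C.
Proof.
move=> tphi; have [sphi cphi _] := tphi.
have DE : 'D_h phi = (fun x => \sum_i h ord0 i * partial i phi x).
  by apply/funext => x; rewrite derive_partial//; exact: (sphi [::]).
have cD : continuous ('D_h phi).
  rewrite DE; apply: continuous_big => [|i _ x]; first exact: add_continuous.
  apply: continuousM; first exact: cst_continuous.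
  by apply: differentiable_continuous; exact: (sphi [:: i]).
split=> //; apply: (continuous_bounded cphi cD) => x nx.
rewrite derive_partial; last exact: (sphi [::]).
by rewrite big1// => i _; rewrite partial_support ?mulr0.
Qed.

Lemma boxbumpB s (a b v x : 'rV[R]_n) :
  boxbump s (a + v) (b + v) x = boxbump s a b (x - v).
Proof.
rewrite /boxbump /tensor; apply: eq_bigr => i _; rewrite /bump !mxE.
by congr (flat _ _ _ * flat _ _ _); ring.
Qed.

Definition segment_mean (g : 'I_n -> 'rV[R]_n -> R) (h x : 'rV[R]_n) : R :=
  \int[lam]_(t in I01) dir Omega g h (x + t *: h).

(** For smooth u this is the fundamental theorem of calculus along the segment
    from x to x + h.  In general, by the fundamental lemma, it suffices to
    integrate against a bump phi supported in both Omega and Omega - h.  On the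
    left the translation is moved onto phi.  On the right Fubini takes the
    integral in t outside; for each t, the translate of phi by t h is still a
    test function on Omega, by the hypothesis on segments, and the definition
    of the weak gradient trades h . g for minus the derivative of phi along h.
    The two sides then agree by the fundamental theorem of calculus for phi. *)
Lemma translation_identity u g (h : 'rV[R]_n) : H1 Omega u g ->
  (forall x, Omega x -> Omega (x + h) -> forall t, 0 <= t <= 1 -> Omega (x + t *: h)) ->
  leb.-integrable setT (EFin \o segment_mean g h) /\
  {ae leb, forall x, Omega x -> Omega (x + h) ->
    ext Omega u (x + h) - ext Omega u x = segment_mean g h x}.
Proof.
move=> H cO; have [u2 g2 _] := H.
set ub := ext Omega u; set G := dir Omega g h.
have iu : leb.-integrable setT (EFin \o ub) by exact: L2_ext_integrable.
have iG : leb.-integrable setT (EFin \o G) by exact: integrable_dir.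
have mG : measurable_fun setT G by apply/measurable_EFinP; exact: measurable_int iG.
have mu : measurable_fun setT ub by apply/measurable_EFinP; exact: measurable_int iu.
pose f0 (p : 'rV[R]_n * measurableTypeR R) := G (p.1 + p.2 *: h).
have mf0 : measurable_fun setT f0.
  by apply: measurableT_comp => //; exact: measurable_segment.
have f0oo : (\int[lam]_(t in I01) \int[leb]_x `|f0 (x, t)|%:E < +oo)%E.
  by apply: (fubini01_dominated (G := G) (h := h) (C := 1)) => // x t; rewrite mul1r.
have iI : leb.-integrable setT (EFin \o segment_mean g h).
  exact: (integrable_int01 mf0 f0oo).
split=> //.
have cs : continuous (fun x : 'rV[R]_n => x + h).
  by move=> x; apply: (cvgD cvg_id (cvg_cst h)).
have oU : open (Omega `&` (fun x => x + h) @^-1` Omega).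
  by apply: openI => //; apply: open_comp => // x _.
have iw : leb.-integrable setT (EFin \o (fun x => ub (x + h) - ub x - segment_mean g h x)).
  have ius := integrable_shift h iu.
  exact: (integrableB measurableT (integrableB measurableT ius iu) iI).
suff W : forall a b (s : R), 0 < s -> rbox a b `<=` Omega `&` (fun x => x + h) @^-1` Omega ->
    (\int[leb]_x ((ub (x + h) - ub x - segment_mean g h x) * boxbump s a b x)%R%:E = 0)%E.
  have := fundamental_lemma oU iw W; apply: filterS => x Hx Ox Oxh.
  by apply/eqP; rewrite -subr_eq0; apply/eqP; exact: Hx.
move=> a b s s0 abU; set phi := boxbump s a b.
have phiE t x : boxbump s (a + t *: h) (b + t *: h) x = phi (x + t *: - h).
  by rewrite boxbumpB scalerN.
have tphi t : 0 <= t <= 1 -> test_function Omega (boxbump s (a + t *: h) (b + t *: h)).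
  move=> t01; apply: test_function_boxbump => // x xab.
  have xab' : rbox a b (x - t *: h).
    by move=> i; have := xab i; rewrite !mxE lerBrDr lerBlDr.
  have [Oy Oyh] := abU _ xab'.
  by have := cO _ Oy Oyh t t01; rewrite subrK.
have tphi0 : test_function Omega phi.
  by have := tphi 0; rewrite scale0r !addr0; apply; rewrite lexx ler01.
have [sphi _ _] := tphi0.
have mphi : measurable_fun setT phi by exact: measurable_smooth.
have phi1 x : `|phi x| <= 1 by exact: boxbump_norm_le1.
have [cD [C DC]] := test_function_derive (- h) tphi0.
have mD : measurable_fun setT ('D_(- h) phi) by exact: measurable_continuousrV.
have i1 : leb.-integrable setT (fun x => (ub (x + h) * phi x)%:E).
  apply: (integrable_mul_bounded (C := 1) measurableT _ mphi) => //.
  exact: (integrable_shift h iu).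
have i2 : leb.-integrable setT (fun x => (ub x * phi x)%:E).
  exact: (integrable_mul_bounded (C := 1) measurableT _ mphi).
have i3 : leb.-integrable setT (fun x => (segment_mean g h x * phi x)%:E).
  exact: (integrable_mul_bounded (C := 1) measurableT _ mphi).
rewrite (eq_integral (fun x : 'rV[R]_n => (ub (x + h)%R * phi x)%:E - (ub x * phi x)%:E
    - (segment_mean g h x * phi x)%:E)%E); last first.
  by move=> x _; rewrite !mulrBl.
rewrite integralB//; last exact: integrableB.
rewrite integralB//.
(* The translation of u is moved onto phi. *)
have E1 : (\int[leb]_x (ub (x + h) * phi x)%R%:E = \int[leb]_x (ub x * phi (x - h))%R%:E)%E.
  rewrite -(integral_shift h (f := fun x => (ub x * phi (x - h))%:E)); last first.
    apply: (integrable_mul_bounded (C := 1)) => //.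
    by apply: measurableT_comp => //; exact: measurable_shift.
  by apply: eq_integral => x _; rewrite addrK.
(* f1 and f2 are the integrands before and after the derivative is moved from u
to phi; their integrals agree for each t separately (E5). *)
pose f1 (p : 'rV[R]_n * measurableTypeR R) := phi p.1 * G (p.1 + p.2 *: h).
have mf1 : measurable_fun setT f1.
  by apply: measurable_funM => //; apply: measurableT_comp => //; exact: measurable_fst.
have f1oo : (\int[lam]_(t in I01) \int[leb]_x `|f1 (x, t)|%:E < +oo)%E.
  by apply: (fubini01_dominated (G := G) (h := h) (C := 1)) => // x t; rewrite /f1 normrM ler_wpM2r.
pose f2 (p : 'rV[R]_n * measurableTypeR R) := ub p.1 * 'D_(- h) phi (p.1 + p.2 *: - h).
have mf2 : measurable_fun setT f2.
  apply: measurable_funM; first by apply: measurableT_comp => //; exact: measurable_fst.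
  exact: (measurableT_comp (f := 'D_(- h) phi) mD (measurable_segment (- h))).
have f2oo : (\int[lam]_(t in I01) \int[leb]_x `|f2 (x, t)|%:E < +oo)%E.
  apply: (fubini01_dominated (G := ub) (h := 0) (C := C)) => // x t.
  by rewrite scaler0 addr0 /f2 normrM mulrC ler_wpM2r.
have E3 : (\int[leb]_x (segment_mean g h x * phi x)%R%:E = \int[leb]_x (int01 f1 x)%:E)%E.
  apply: ae_eq_integral => //.
  - exact: measurable_int i3.
  - exact: measurable_int (integrable_int01 mf1 f1oo).
  have := ae_integrable01 mf0 f0oo; apply: filterS => x ix _.
  by rewrite /int01 /f1 /= RintegralZl//= mulrC.
have E4 : (\int[leb]_x (int01 f2 x)%:E = \int[leb]_x (ub x * phi (x - h))%R%:E - \int[leb]_x (ub x * phi x)%R%:E)%E.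
  rewrite -integralB//.
    apply: eq_integral => x _; rewrite -EFinB -mulrBr; congr EFin.
    have D1 y : derivable phi y (- h).
      by apply: diff_derivable; exact: (sphi [::]).
    (* The fundamental theorem of calculus for phi along the segment from x to x - h. *)
    have F := ftc_segment x D1 cD.
    rewrite /int01 /f2 /= RintegralZl//=; last first.
      apply: continuous_compact_integrable; first exact: segment_compact.
      apply: continuous_subspaceT => t.
      apply: (@continuous_comp _ _ _ (fun t : R => x + t *: - h) ('D_(- h) phi)); last exact: cD.
      apply: cvgD; first exact: cvg_cst.
      by apply: cvgZr_tmp => //; exact: cvg_id.
    by rewrite /Rintegral F.
  apply: (integrable_mul_bounded (C := 1)) => //.
  by apply: measurableT_comp => //; exact: measurable_shift.
have E5 : (\int[leb]_x (int01 f1 x)%:E = \int[leb]_x (int01 f2 x)%:E)%E.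
  rewrite (fubini01 mf1 f1oo) (fubini01 mf2 f2oo); apply: eq_integral => t; rewrite inE/= in_itv/= => t01.
  set phit := boxbump s (a + t *: h) (b + t *: h).
  have tphit : test_function Omega phit by exact: tphi.
  have [C1 HC1] := test_function_bounded tphit; have [sphit _ _] := tphit.
  transitivity (\int[leb]_x (G x * phit x)%R%:E)%E.
    rewrite -(integral_shift (t *: h) (f := fun x => (G x * phit x)%R%:E)).
      by apply: eq_integral => x _; rewrite /f1 /phit boxbumpB addrK mulrC.
    exact: (integrable_mul_bounded (C := C1) measurableT iG (measurable_smooth sphit)).
  rewrite (weak_gradient_dir oO bO h H tphit); apply: eq_integral => x _.
  have -> : phit = (fun y => phi (y + t *: - h)) by apply/funext => y; rewrite /phit phiE.
  by rewrite derive_shift.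
rewrite E1 E3 E5 E4 subee// fin_numB.
apply/andP; split; apply: integrable_fin_num => //.
apply: (integrable_mul_bounded (C := 1)) => //.
by apply: measurableT_comp => //; exact: measurable_shift.
Qed.

End translation.

(** * The Poincare inequality *)

Section inequalities.
Context (R : realType).

Lemma sum_sq_le n (a : 'I_n -> R) :
  (\sum_i a i) ^+ 2 <= n%:R * \sum_i a i ^+ 2.
Proof.
have E : 2 * (n%:R * \sum_i a i ^+ 2) = \sum_i \sum_j (a i ^+ 2 + a j ^+ 2).
  under [RHS]eq_bigr do rewrite big_split/= sumr_const card_ord.
  by rewrite big_split/= sumr_const card_ord sumrMnl [n%:R * _]mulr_natl mulr_natl mulr2n.
rewrite -(ler_pM2l (ltr0n _ 2)) E expr2 mulr_suml mulr_sumr; apply: ler_sum => i _.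
rewrite !mulr_sumr; apply: ler_sum => j _.
have := sqr_ge0 (a i - a j); rewrite sqrrB; lra.
Qed.

Local Notation lam := (@lebesgue_measure R).
Local Notation I01 := (`[0%R, 1%R]%classic : set (measurableTypeR R)).

(** Integrate 2 m f - m^2 <= f^2, where m is the mean of f. *)
Lemma jensen01 (f : R -> R) : measurable_fun I01 f ->
  (((\int[lam]_(t in I01) f t) ^+ 2)%:E <= \int[lam]_(t in I01) (f t ^+ 2)%:E)%E.
Proof.
move=> mf; have mI : measurable I01 by exact: measurable_itv.
have I1 : lam I01 = 1%E by apply: etrans (lebesgue_measure_itv _) _; rewrite /= lte_fin ltr01 sube0.
have mf2 : measurable_fun I01 (fun t => f t ^+ 2) by exact: measurable_funX.
have := leey (\int[lam]_(t in I01) (f t ^+ 2)%:E)%E; rewrite le_eqVlt => /predU1P[->|foo].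
  by rewrite leey.
have i2 : lam.-integrable I01 (fun t => (f t ^+ 2)%:E).
  apply/integrableP; split; first exact/measurable_EFinP.
  by under eq_integral do rewrite gee0_abs ?lee_fin ?sqr_ge0//.
have Ioo : (lam I01 < +oo)%E by rewrite I1 ltry.
have i1 := integrable_sq mI Ioo mf i2.
set m := \int[lam]_(t in I01) f t.
rewrite -(fineK (integrable_fin_num mI i2)) lee_fin -/(Rintegral lam I01 (fun t => f t ^+ 2)).
have i3 : lam.-integrable I01 (fun=> (m ^+ 2)%:E).
  apply/integrableP; split; first exact: measurable_cst.
  by rewrite integral_cst//= I1 mule1 ltry.
have ib := integrableZl mI (2 * m) i1.
have ic : lam.-integrable I01 (EFin \o (fun t => 2 * m * f t - m ^+ 2)).
  exact: (integrableB mI ib i3).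
have -> : m ^+ 2 = \int[lam]_(t in I01) (2 * m * f t - m ^+ 2).
  rewrite (RintegralB mI ib i3) RintegralZl// -/m Rintegral_cst//.
  rewrite [X in fine X](_ : _ = 1%E); last exact: I1.
  by rewrite /=; ring.
apply: le_Rintegral => // t _.
have := sqr_ge0 (f t - m); rewrite sqrrB; lra.
Qed.

Section tonelli01.
Context (n : nat) (F : 'rV[R]_n * measurableTypeR R -> \bar R).
Hypotheses (mF : measurable_fun setT F) (F0 : forall p, (0 <= F p)%E).

Let H (p : 'rV[R]_n * measurableTypeR R) : \bar R := (F p * (\1_I01 p.2)%:E)%E.

Let mH : measurable_fun setT H.
Proof.
apply: emeasurable_funM => //; apply/measurable_EFinP.
apply: measurableT_comp; last exact: measurable_snd.
by apply: measurable_indic; exact: measurable_itv.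
Qed.

Let H0 p : (0 <= H p)%E. Proof. by rewrite mule_ge0// lee_fin. Qed.

Let HE x : (\int[lam]_(t in I01) F (x, t) = \int[lam]_t H (x, t))%E.
Proof.
rewrite integral_mkcond; apply: eq_integral => t _; rewrite patchE /H/= indicE.
by case: ifP; rewrite ?mule1 ?mule0.
Qed.

Lemma measurable_integral01 :
  measurable_fun setT (fun x => \int[lam]_(t in I01) F (x, t))%E.
Proof.
under eq_fun do rewrite HE.
exact: (@measurable_fun_fubini_tonelli_F _ _ _ _ _ lam H).
Qed.

Lemma tonelli01 :
  (\int[lebesgue_rV R n]_x \int[lam]_(t in I01) F (x, t) =
   \int[lam]_(t in I01) \int[lebesgue_rV R n]_x F (x, t))%E.
Proof.
under eq_integral do rewrite HE.
rewrite (fubini_tonelli H mH H0) [RHS]integral_mkcond.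
apply: eq_integral => t _; rewrite patchE /H/= indicE; case: ifP => _.
  by apply: eq_integral => x _; rewrite mule1.
by rewrite integral0_eq// => x _; rewrite mule0.
Qed.

End tonelli01.

End inequalities.

Section poincare.
Context (R : realType) (n : nat) (Omega : set 'rV[R]_n).
Local Notation leb := (lebesgue_rV R n).
Local Notation lam := (@lebesgue_measure R).
Local Notation I01 := (`[0%R, 1%R]%classic : set (measurableTypeR R)).
Hypotheses (oO : open Omega) (bO : bounded_set Omega) (cO : convex_set Omega).

Let mO : measurable Omega := measurable_openrV oO.

Lemma convex_segment (x h : 'rV[R]_n) : Omega x -> Omega (x + h) ->
  forall t, 0 <= t <= 1 -> Omega (x + t *: h).
Proof.
move=> Ox Oxh t /andP[t0 t1].
have s0 : 0 <= 1 - t by rewrite subr_ge0.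
have s1 : 1 - t <= 1 by rewrite lerBlDr lerDl.
have := @cO x (x + h) (Itv01 s0 s1); rewrite !inE => /(_ Ox Oxh).
rewrite /conv /= /isConvexSpace.conv /=.
rewrite /unstable.onem.
by rewrite opprB addrCA subrr addr0 scalerDr addrA -scalerDl subrK scale1r.
Qed.

Definition energy (g : 'I_n -> 'rV[R]_n -> R) : \bar R :=
  (\int[leb]_x (\sum_i ext Omega (g i) x ^+ 2)%:E)%E.

Lemma energy_ge0 g : (0 <= energy g)%E.
Proof. by apply: integral_ge0 => x _; rewrite lee_fin sumr_ge0// => i _; rewrite sqr_ge0. Qed.

(** The indicators restrict the extended function to pairs of points of Omega,
    across whose segments the gradient controls the difference. *)
Definition diffsq (u : 'rV[R]_n -> R) (p : 'rV[R]_n * 'rV[R]_n) : \bar R :=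
  ((\1_Omega p.1 * \1_Omega p.2) * (ext Omega u p.2 - ext Omega u p.1) ^+ 2)%:E.

Lemma diffsq_ge0 u p : (0 <= diffsq u p)%E.
Proof. by rewrite lee_fin mulr_ge0 ?sqr_ge0. Qed.

Lemma measurable_diffsq u : measurable_fun Omega u ->
  measurable_fun setT (diffsq u).
Proof.
move=> /(measurable_ext oO) mu; apply/measurable_EFinP.
have m1 : measurable_fun setT (\1_Omega : 'rV[R]_n -> R) by exact: measurable_indic.
have c1 (f : 'rV[R]_n -> R) : measurable_fun setT f ->
    measurable_fun setT (fun p : 'rV[R]_n * 'rV[R]_n => f p.1).
  by move=> mf; exact: (measurableT_comp mf measurable_fst).
have c2 (f : 'rV[R]_n -> R) : measurable_fun setT f ->
    measurable_fun setT (fun p : 'rV[R]_n * 'rV[R]_n => f p.2).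
  by move=> mf; exact: (measurableT_comp mf measurable_snd).
apply: measurable_funM.
  by apply: measurable_funM; [exact: c1|exact: c2].
by apply: measurable_funX; apply: measurable_funB; [exact: c2|exact: c1].
Qed.

Lemma dir_sq_le g (h x : 'rV[R]_n) (r : R) : (forall i, `|h ord0 i| <= r) ->
  dir Omega g h x ^+ 2 <= n%:R * r ^+ 2 * \sum_i ext Omega (g i) x ^+ 2.
Proof.
move=> hr; rewrite /dir (le_trans (sum_sq_le _))// -mulrA ler_wpM2l//.
rewrite mulr_sumr; apply: ler_sum => i _; rewrite exprMn ler_wpM2r ?sqr_ge0//.
by rewrite -[leLHS]ger0_norm ?sqr_ge0// normrX lerXn2r// ?nnegrE// (le_trans _ (hr i)).
Qed.

Lemma measurable_dir g h : (forall i, L2 Omega (g i)) ->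
  measurable_fun setT (dir Omega g h).
Proof. by move=> /(integrable_dir oO bO h)/measurable_int/measurable_EFinP. Qed.

Lemma measurable_energy_density (g : 'I_n -> 'rV[R]_n -> R) : (forall i, L2 Omega (g i)) ->
  measurable_fun setT (fun x : 'rV[R]_n => \sum_i ext Omega (g i) x ^+ 2).
Proof.
move=> g2; apply: measurable_sum => i.
by apply: measurable_funX; apply: (measurable_ext oO); have [] := g2 i.
Qed.

(** Square the translation identity, apply Jensen's inequality on the unit
    interval and Cauchy-Schwarz to h . g, then integrate over x: every
    translate of the energy density has the same integral. *)
Lemma segment_diffsq u g (h : 'rV[R]_n) (r : R) : H1 Omega u g ->
  (forall i, `|h ord0 i| <= r) ->
  (\int[leb]_x diffsq u (x, (x + h)%R) <= (n%:R * r ^+ 2)%:E * energy g)%E.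
Proof.
move=> H hr; have [[mu u2] g2 _] := H.
have [iI tr] := translation_identity oO bO H (fun x => @convex_segment x h).
have mE : measurable_fun setT (fun x : 'rV[R]_n => (\sum_i ext Omega (g i) x ^+ 2)%:E).
  by apply/measurable_EFinP; exact: measurable_energy_density.
set G := dir Omega g h; have mG : measurable_fun setT G by exact: measurable_dir.
have mI : measurable_fun setT (segment_mean Omega g h).
  by apply/measurable_EFinP; exact: measurable_int iI.
pose F (p : 'rV[R]_n * measurableTypeR R) : \bar R := (G (p.1 + p.2 *: h) ^+ 2)%:E.
have mGs : measurable_fun setT (fun p : 'rV[R]_n * measurableTypeR R => G (p.1 + p.2 *: h)).
  exact: (measurableT_comp mG (measurable_segment h)).
have mF : measurable_fun setT F by apply/measurable_EFinP; exact: measurable_funX.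
have mG2 : measurable_fun setT (fun x => (G x ^+ 2)%:E).
  by apply/measurable_EFinP; exact: measurable_funX.
have mI2 : measurable_fun setT (fun x => (segment_mean Omega g h x ^+ 2)%:E).
  by apply/measurable_EFinP; exact: measurable_funX.
pose I1 x : \bar R := (\1_Omega x * \1_Omega (x + h) * segment_mean Omega g h x ^+ 2)%:E.
have m1h : measurable_fun setT (fun x => \1_Omega x * \1_Omega (x + h) : R).
  apply: measurable_funM; first exact: measurable_indic.
  by apply: (measurableT_comp _ (measurable_shift h)); exact: measurable_indic.
have mI1 : measurable_fun setT I1.
  by apply/measurable_EFinP; apply: measurable_funM => //; exact: measurable_funX.
have mD : measurable_fun setT (fun x : 'rV[R]_n => diffsq u (x, x + h)).
  apply: (measurableT_comp (measurable_diffsq mu)).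
  by apply: measurable_fun_pair => //; exact: measurable_shift.
apply: (@le_trans _ _ (\int[leb]_x I1 x)%E).
  rewrite le_eqVlt; apply/orP; left; apply/eqP.
  apply: ge0_ae_eq_integral => //.
  - by move=> x _; exact: diffsq_ge0.
  - by move=> x _; rewrite lee_fin mulr_ge0 ?sqr_ge0.
  apply: filterS tr => x Hx _; rewrite /diffsq /I1 /= !indicE.
  have [/set_mem Ox|_] := boolP (x \in Omega); last by rewrite !mul0r.
  have [/set_mem Oxh|_] := boolP (x + h \in Omega); last by rewrite mulr0 !mul0r.
  by rewrite Hx.
apply: (@le_trans _ _ (\int[leb]_x (segment_mean Omega g h x ^+ 2)%:E)%E).
  apply: ge0_le_integral => //.
  - by move=> x _; rewrite lee_fin mulr_ge0 ?sqr_ge0.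
  - move=> x _; rewrite lee_fin ler_piMl ?sqr_ge0// !indicE.
apply: (@le_trans _ _ (\int[leb]_x \int[lam]_(t in I01) F (x, t))%E).
  apply: ge0_le_integral => //.
  - by move=> x _; rewrite lee_fin sqr_ge0.
  - by apply: measurable_integral01 => // p; rewrite lee_fin sqr_ge0.
  move=> x _; apply: jensen01; apply: measurable_funTS.
  exact: (measurableT_comp mGs (measurable_pair1 x)).
rewrite tonelli01//; last by move=> p; rewrite lee_fin sqr_ge0.
rewrite (eq_integral (fun=> \int[leb]_x (G x ^+ 2)%:E)%E); last first.
  move=> t _; rewrite -(ge0_integral_shift (t *: h) (f := fun x => (G x ^+ 2)%:E))//.
  by move=> x; rewrite lee_fin sqr_ge0.
rewrite integral_I01_cst /energy -ge0_integralZl//.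
- apply: ge0_le_integral => //.
  + by move=> x _; rewrite lee_fin sqr_ge0.
  + exact: measurable_funeM.
  + by move=> x _; rewrite -EFinM lee_fin; exact: dir_sq_le.
- by move=> x _; rewrite lee_fin sumr_ge0// => i _; rewrite sqr_ge0.
- by rewrite lee_fin mulr_ge0 ?sqr_ge0.
Qed.

(** Substitute y = x + h and integrate the bound for a fixed h over those h that
    join two points of Omega; they lie in a cube since Omega is bounded. *)
Lemma poincare : exists2 K : R, 0 <= K & forall u g, H1 Omega u g ->
  (\int[leb]_x \int[leb]_y diffsq u (x, y) <= K%:E * energy g)%E.
Proof.
have [r r0 Or] := bounded_sub_cube bO.
pose c := n%:R * (2 * r) ^+ 2 : R.
have c0 : 0 <= c by rewrite mulr_ge0// sqr_ge0.
pose Q := @cube R n (2 * r).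
have Qoo : (leb Q < +oo)%E by exact: lebesgue_rbox_lty.
have Qfin : leb Q \is a fin_num by rewrite ge0_fin_numE.
exists (c * fine (leb Q)); first by rewrite mulr_ge0// fine_ge0.
move=> u g H; have [[mu u2] g2 _] := H.
pose P (p : 'rV[R]_n * 'rV[R]_n) := diffsq u (p.1, p.1 + p.2).
have mD := measurable_diffsq mu.
have mP : measurable_fun setT P.
  apply: (measurableT_comp mD); apply: measurable_fun_pair; first exact: measurable_fst.
  apply: measurable_fun_rV => i; under eq_fun do rewrite mxE.
  apply: measurable_funD.
    exact: (measurableT_comp (measurable_coordR i) measurable_fst).
  exact: (measurableT_comp (measurable_coordR i) measurable_snd).
have P0 p : (0 <= P p)%E by exact: diffsq_ge0.
rewrite (eq_integral (fun x => \int[leb]_h P (x, h))%E); last first.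
  move=> x _; rewrite -(ge0_integral_shift x (f := fun y => diffsq u (x, y))).
  - by apply: eq_integral => h _; rewrite /P /= addrC.
  - exact: (measurableT_comp mD (measurable_pair1 x)).
  - by move=> y; exact: diffsq_ge0.
rewrite (fubini_tonelli P mP P0).
have cE0 : (0 <= c%:E * energy g)%E by rewrite mule_ge0// energy_ge0.
apply: (@le_trans _ _ (\int[leb]_(h in Q) (c%:E * energy g))%E).
  rewrite [leRHS]integral_mkcond; apply: ge0_le_integral => //.
  - by move=> h _; apply: integral_ge0.
  - exact: measurable_fun_fubini_tonelli_G.
  - by apply: (measurable_restrictT _ _).1; [exact: measurable_rbox|exact: measurable_cst].
  move=> h _; rewrite patchE; case: ifPn => [/set_mem Qh|/negP Qh].
    apply: (segment_diffsq H) => i.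
    by have := Qh i; rewrite !mxE -ler_norml.
  rewrite integral0_eq// => x _; rewrite /P /diffsq /= !indicE.
  have [/set_mem Ox|_] := boolP (x \in Omega); last by rewrite !mul0r.
  have [/set_mem Oxh|_] := boolP (x + h \in Omega); last by rewrite mulr0 !mul0r.
  exfalso; apply: Qh; apply/mem_set => i.
  have /andP[] := Or _ Ox i; have /andP[] := Or _ Oxh i; rewrite !mxE.
  by move=> *; apply/andP; split; lra.
rewrite integral_cst//; last exact: measurable_rbox.
by rewrite [(c * _)%:E]EFinM fineK// muleAC.
Qed.

End poincare.

(** * The spectral gap *)

Section divergence.
Context (R : realType) (n : nat).
Local Notation leb := (lebesgue_rV R n).
Local Notation lam := (@lebesgue_measure R).
Local Notation I01 := (`[0%R, 1%R]%classic : set (measurableTypeR R)).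

(** Averaging over the translates by t h, 0 <= t <= 1, does not change the
    integral of the derivative and turns it into the integral of
    psi (x + h) - psi x, which vanishes by invariance. *)
Lemma integral_derive0 (psi : 'rV[R]_n -> R) (h : 'rV[R]_n) :
  (forall y, derivable psi y h) -> continuous ('D_h psi) ->
  leb.-integrable setT (EFin \o psi) -> leb.-integrable setT (EFin \o 'D_h psi) ->
  (\int[leb]_x ('D_h psi x)%:E = 0)%E.
Proof.
move=> dpsi cD ipsi iD.
have mD : measurable_fun setT ('D_h psi).
  by apply/measurable_EFinP; exact: measurable_int iD.
pose f (p : 'rV[R]_n * measurableTypeR R) := 'D_h psi (p.1 + p.2 *: h).
have mf : measurable_fun setT f.
  exact: (measurableT_comp (f := 'D_h psi) mD (measurable_segment h)).
have foo : (\int[lam]_(t in I01) \int[leb]_x `|f (x, t)|%:E < +oo)%E.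
  by apply: (fubini01_dominated (G := 'D_h psi) (h := h) (C := 1) mf iD) => x t; rewrite mul1r.
have := fubini01 mf foo.
rewrite [RHS](_ : _ = \int[leb]_x ('D_h psi x)%:E)%E; last first.
  rewrite -[RHS]integral_I01_cst; apply: eq_integral => t _.
  by rewrite -(integral_shift (t *: h) iD).
move=> <-.
have iph := integrable_shift h ipsi.
rewrite (eq_integral (fun x : 'rV[R]_n => (psi (x + h)%R)%:E - (psi x)%:E)%E); last first.
  by move=> x _; rewrite /int01 /f /= /Rintegral (ftc_segment x dpsi cD).
rewrite (integralB measurableT iph ipsi) (integral_shift h ipsi) subee//.
exact: integrable_fin_num.
Qed.

Lemma integrable_bounded_support (Omega : set 'rV[R]_n) (f : 'rV[R]_n -> R) (C : R) :
  measurable Omega -> (leb Omega < +oo)%E -> measurable_fun setT f ->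
  (forall x, `|f x| <= C) -> (forall x, ~ Omega x -> f x = 0) ->
  leb.-integrable setT (EFin \o f).
Proof.
move=> mO Ooo mf fC f0.
have i1 : leb.-integrable setT (EFin \o (\1_Omega : 'rV[R]_n -> R)).
  apply/integrableP; split; first by apply/measurable_EFinP; exact: measurable_indic.
  under eq_integral do rewrite gee0_abs ?lee_fin//.
  by rewrite integral_indic// setIT.
have := integrable_mul_bounded measurableT i1 mf (fun x _ => fC x).
apply: eq_integrable => // x _; rewrite /= indicE.
have [_|/negP Ox] := boolP (x \in Omega); first by rewrite mul1r.
by rewrite mul0r f0// => Oy; apply: Ox; exact: mem_set.
Qed.

Lemma integral_partial0 (Omega : set 'rV[R]_n) phi i :
  open Omega -> bounded_set Omega -> test_function Omega phi ->
  (\int[leb]_x (partial i phi x)%:E = 0)%E.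
Proof.
move=> oO bO tphi; have [sphi _ _] := tphi.
have mO := measurable_openrV oO.
have Ooo := bounded_lebesgue_lty mO bO.
have [C1 HC1] := test_function_bounded tphi.
have [C2 HC2] := test_function_partial_bounded i tphi.
apply: integral_derive0.
- by move=> y; apply: diff_derivable; exact: (sphi [::]).
- exact: continuous_partial.
- apply: (integrable_bounded_support mO Ooo (measurable_smooth sphi) HC1).
  by move=> x /(test_function_out tphi)[].
- have := integrable_bounded_support mO Ooo (measurable_partial i sphi) HC2; apply.
  by move=> x /(test_function_out tphi)[].
Qed.

End divergence.

Section gap.
Context (R : realType) (n : nat) (Omega : set 'rV[R]_n).
Local Notation leb := (lebesgue_rV R n).
Hypotheses (oO : open Omega) (bO : bounded_set Omega).

Let mO : measurable Omega := measurable_openrV oO.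
Let Ooo : (leb Omega < +oo)%E := bounded_lebesgue_lty mO bO.

Lemma finite_measure_integrable (f : 'rV[R]_n -> R) (C : R) :
  measurable_fun Omega f -> (forall x, Omega x -> `|f x| <= C) ->
  leb.-integrable Omega (EFin \o f).
Proof.
move=> mf fC; apply: (le_integrable mO (g := cst C%:E)).
- exact/measurable_EFinP.
- by move=> x Ox /=; rewrite lee_fin (le_trans (fC x Ox))// ler_norm.
apply/integrableP; split; first exact: measurable_cst.
by rewrite /= integral_cst//= lte_mul_pinfty.
Qed.

Lemma L2_bounded (f : 'rV[R]_n -> R) (C : R) :
  measurable_fun Omega f -> (forall x, Omega x -> `|f x| <= C) -> L2 Omega f.
Proof.
move=> mf fC; split=> //.
apply: (finite_measure_integrable (C := C ^+ 2)); first exact: measurable_funX.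
move=> x Ox; rewrite normrX lerXn2r// ?nnegrE//; last exact: fC.
exact: le_trans (fC x Ox).
Qed.

Lemma H1_cst (c : R) : H1 Omega (fun=> c) (fun _ _ => 0).
Proof.
split.
- by apply: (L2_bounded (C := `|c|)) => //; exact: measurable_cst.
- by move=> i; apply: (L2_bounded (C := 0)) => [|x _]; [exact: measurable_cst|rewrite normr0].
move=> i phi tphi; have [sphi _ _] := tphi.
rewrite [in RHS]/Rintegral integral0_eq; last by move=> x _; rewrite mul0r.
rewrite oppr0; have [C2 HC2] := test_function_partial_bounded i tphi.
rewrite RintegralZl//; last first.
  apply: (finite_measure_integrable (C := C2)) => //.
  by apply: measurable_funTS; exact: measurable_partial.
rewrite /Rintegral integral_ext (eq_integral (fun x => (partial i phi x)%:E)).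
  by rewrite (integral_partial0 i oO bO tphi) mulr0.
move=> x _; rewrite /ext; case: ifPn => // /negP Ox.
by have [_ ->] := test_function_out tphi (fun Oy => Ox (mem_set Oy)).
Qed.

Lemma integrable_L2M u v : L2 Omega u -> L2 Omega v ->
  leb.-integrable Omega (EFin \o (fun x => u x * v x)).
Proof.
move=> [mu u2] [mv v2].
apply: (le_integrable mO (g := fun x => ((u x ^+ 2)%:E + (v x ^+ 2)%:E)%E)).
- by apply/measurable_EFinP; exact: measurable_funM.
- move=> x _; rewrite -EFinD !abse_EFin lee_fin [leRHS]ger0_norm ?addr_ge0 ?sqr_ge0//.
  rewrite normrM -[u x ^+ 2]ger0_norm ?sqr_ge0// -[v x ^+ 2]ger0_norm ?sqr_ge0// !normrX.
  have := sqr_ge0 (`|u x| - `|v x|); rewrite sqrrB.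
  by have := mulr_ge0 (normr_ge0 (u x)) (normr_ge0 (v x)); lra.
- exact: integrableD.
Qed.

Lemma integrable_sumM (g h : 'I_n -> 'rV[R]_n -> R) :
  (forall i, L2 Omega (g i)) -> (forall i, L2 Omega (h i)) ->
  leb.-integrable Omega (EFin \o (fun x => \sum_i g i x * h i x)).
Proof.
move=> g2 h2; rewrite (_ : _ \o _ = fun x => (\sum_i (g i x * h i x)%R%:E)%E).
  by apply: integrable_sum => // i _; exact: integrable_L2M.
by apply/funext => x; rewrite /= sumEFin.
Qed.

Lemma energyE g : (forall i, L2 Omega (g i)) ->
  energy Omega g = (\int[leb]_(x in Omega) (\sum_i g i x * g i x))%:E.
Proof.
move=> g2; rewrite /Rintegral fineK; last first.
  exact: (integrable_fin_num mO (integrable_sumM g2 g2)).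
rewrite integral_ext; apply: eq_integral => x _; congr EFin.
rewrite /ext; case: ifP => _; first by apply: eq_bigr => i _; rewrite expr2.
by rewrite big1// => i _; rewrite expr0n.
Qed.

(** A nonnegative function with integral 0 vanishes almost everywhere. *)
Lemma sq_integral0 u : L2 Omega u -> \int[leb]_(x in Omega) (u x * u x) = 0 ->
  is_zero_on Omega u.
Proof.
move=> u2 I0; have [mu _] := u2.
have iuu := integrable_L2M u2 u2.
have muu : measurable_fun Omega (EFin \o (fun x => u x * u x)).
  exact: measurable_int iuu.
have : (\int[leb]_(x in Omega) `|(EFin \o (fun x => u x * u x)%R) x| = 0)%E.
  rewrite (eq_integral (EFin \o (fun x => u x * u x))); last first.
    by move=> x _; rewrite gee0_abs// lee_fin -expr2 sqr_ge0.
  by rewrite -(fineK (integrable_fin_num mO iuu)) -/(Rintegral leb Omega (fun x => u x * u x)) I0.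
move=> /(ae_eq_integral_abs leb mO muu).
apply: filterS => x Hx Ox; have [/eqP] := Hx Ox.
by rewrite mulf_eq0 orbb => /eqP.
Qed.

Hypotheses (cO : convex_set Omega) (O0 : Omega !=set0).

Let vol := fine (leb Omega).

Let vol_gt0 : 0 < vol.
Proof. by rewrite fine_gt0// open_lebesgue_gt0//=. Qed.

Let volE : leb Omega = vol%:E.
Proof. by rewrite fineK// ge0_fin_numE. Qed.

Lemma integral_diffsq u x : Omega x -> L2 Omega u ->
  (\int[leb]_y diffsq Omega u (x, y) = \int[leb]_(y in Omega) ((u y - u x) ^+ 2)%R%:E)%E.
Proof.
move=> Ox u2; rewrite [RHS]integral_ext; apply: eq_integral => y _.
rewrite /diffsq /ext /= !indicE (mem_set Ox) mul1r; congr EFin.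
by case: ifP; rewrite ?mul1r ?mul0r.
Qed.

(** Expand the square and drop the integral of (u y)^2; the cross term vanishes
    since u has mean 0. *)
Lemma mean0_diffsq u : L2 Omega u -> \int[leb]_(x in Omega) u x = 0 ->
  ((vol * \int[leb]_(x in Omega) (u x * u x))%R%:E <=
    \int[leb]_x \int[leb]_y diffsq Omega u (x, y))%E.
Proof.
move=> u2 I0; have [mu sqi] := u2.
have iu : leb.-integrable Omega (EFin \o u) by exact: L2_integrable.
have iuu := integrable_L2M u2 u2.
have mD := measurable_diffsq oO mu.
rewrite EFinM [X in (_ * X)%E]fineK; last exact: (integrable_fin_num mO iuu).
rewrite integral_ext -ge0_integralZl//.
- apply: ge0_le_integral => //.
  + move=> x _; rewrite mule_ge0// ?lee_fin ?(ltW vol_gt0)//.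
    by rewrite /ext; case: ifP => // _; rewrite -expr2 sqr_ge0.
  + apply: measurable_funeM; apply/measurable_EFinP.
    by apply: (measurable_ext oO); exact: measurable_funM.
  + apply: (@measurable_fun_fubini_tonelli_F _ _ _ _ _ leb (diffsq Omega u)) => //.
    by move=> p; exact: diffsq_ge0.
  move=> x _; rewrite /ext; case: ifPn => [/set_mem Ox|_]; last first.
    by rewrite mule0; apply: integral_ge0 => y _; exact: diffsq_ge0.
  rewrite integral_diffsq//.
  have ic : leb.-integrable Omega (EFin \o (fun=> u x ^+ 2)).
    by apply: (finite_measure_integrable (C := `|u x ^+ 2|)) => //; exact: measurable_cst.
  have ib := integrableZl mO (2 * u x) iu.
  have icb := integrableB mO ic ib.
  have id : leb.-integrable Omega (EFin \o (fun y => (u y - u x) ^+ 2)).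
    have ih := integrableD mO (integrableB mO iuu ib) ic.
    apply: eq_integrable ih => // y _ /=.
    by rewrite -!EFinD; congr EFin; ring.
  rewrite -(fineK (integrable_fin_num mO id)) -/(Rintegral leb Omega (fun y => (u y - u x) ^+ 2)).
  rewrite -EFinM lee_fin.
  have -> : vol * (u x * u x) = \int[leb]_(y in Omega) (u x ^+ 2 - 2 * u x * u y).
    have E1 : \int[leb]_(y in Omega) (u x ^+ 2) = u x ^+ 2 * vol by rewrite Rintegral_cst.
    have E2 : \int[leb]_(y in Omega) (2 * u x * u y) = 0.
      by rewrite RintegralZl// [X in _ * X](_ : _ = 0) ?mulr0.
    transitivity (\int[leb]_(y in Omega) (u x ^+ 2) - \int[leb]_(y in Omega) (2 * u x * u y)).
      by rewrite E1 E2 subr0 mulrC expr2.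
    by apply/esym; exact: (RintegralB mO ic ib).
  apply: le_Rintegral => // y _; rewrite sqrrB; have := sqr_ge0 (u y); lra.
- apply/measurable_EFinP; apply: (measurable_ext oO); exact: measurable_funM.
- by move=> x _; rewrite lee_fin /ext; case: ifP => // _; rewrite -expr2 sqr_ge0.
- by rewrite lee_fin ltW.
Qed.

(** By the Poincare inequality the double integral of (u y - u x)^2 is 0, so for
    some x in Omega the integral over y alone is 0. *)
Lemma energy0_cst u g : H1 Omega u g -> energy Omega g = 0%E ->
  exists m, is_zero_on Omega (fun x => u x - m).
Proof.
move=> H E0; have [u2 g2 _] := H; have [mu sqi] := u2.
have [K K0 HK] := poincare oO bO cO.
have mD := measurable_diffsq oO mu.
pose F x := (\int[leb]_y diffsq Omega u (x, y))%E.
have F0 x : (0 <= F x)%E by apply: integral_ge0 => y _; exact: diffsq_ge0.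
have mF : measurable_fun setT F.
  by apply: measurable_fun_fubini_tonelli_F => // p; exact: diffsq_ge0.
have IF : (\int[leb]_x `|F x| = 0)%E.
  apply/eqP; rewrite eq_le integral_ge0// andbT.
  under eq_integral do rewrite gee0_abs//.
  by have := HK _ _ H; rewrite E0 mule0.
have {}IF := (ae_eq_integral_abs leb measurableT mF).1 IF.
(* A set of positive measure is not contained in a null set. *)
have [x [Ox Fx]] : exists x, Omega x /\ F x = 0%E.
  apply: contrapT => /forallNP nF.
  have [N [mN N0 HN]] := IF.
  have : (leb Omega <= leb N)%E.
    apply: le_measure; rewrite ?inE// => x Ox; apply: HN => /= h.
    by apply: (nF x); split=> //; exact: h.
  by rewrite N0 volE lee_fin leNgt vol_gt0.
exists (u x).
have : (\int[leb]_y `|diffsq Omega u (x, y)| = 0)%E.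
  under eq_integral do rewrite gee0_abs ?diffsq_ge0//.
  exact: Fx.
move=> /(ae_eq_integral_abs leb measurableT (measurableT_comp mD (measurable_pair1 x))).
apply: filterS => y Hy Oy; have [/eqP] := Hy Logic.I.
rewrite !indicE (mem_set Ox) (mem_set Oy) !mul1r sqrf_eq0 !ext_in//.
by move=> /eqP.
Qed.

Lemma neumann_energy mu u g : H1 Omega u g ->
  (forall v h, H1 Omega v h -> \int[leb]_(x in Omega) (\sum_i g i x * h i x) =
      mu * \int[leb]_(x in Omega) (u x * v x)) ->
  energy Omega g = (mu * \int[leb]_(x in Omega) (u x * u x))%:E.
Proof. by move=> H sol; have [_ g2 _] := H; rewrite energyE// (sol _ _ H). Qed.

Lemma sq_integral_gt0 u : L2 Omega u -> ~ is_zero_on Omega u ->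
  0 < \int[leb]_(x in Omega) (u x * u x).
Proof.
move=> u2 nu; rewrite lt_neqAle Rintegral_ge0 => [|x _]; last by rewrite -expr2 sqr_ge0.
by rewrite andbT eq_sym; apply/eqP => /(sq_integral0 u2).
Qed.

(** Testing the equation with the constant 1 shows that an eigenfunction for
    mu <> 0 has mean 0; then vol * int u^2 <= K * mu * int u^2 by the Poincare
    inequality, which bounds mu from below. *)
Lemma eigenvalue_gap : exists2 c : R, 0 < c &
  forall mu, is_eigenvalue Omega mu -> mu < c -> mu = 0.
Proof.
have [K K0 HK] := poincare oO bO cO.
exists (vol / (K + 1)); first by rewrite divr_gt0// ltr_wpDl.
move=> mu [u [g H sol] nu] muc; have [u2 g2 _] := H.
have U0 := sq_integral_gt0 u2 nu.
have EE := neumann_energy H sol.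
have mu0 : 0 <= mu.
  by have := energy_ge0 Omega g; rewrite EE lee_fin pmulr_lge0.
apply/eqP; apply: contraT => mun0.
have I0 : \int[leb]_(x in Omega) u x = 0.
  have := sol _ _ (H1_cst 1).
  rewrite [LHS]/Rintegral integral0_eq => [/= /esym/eqP|x _]; last first.
    by rewrite big1// => i _; rewrite mulr0.
  rewrite mulf_eq0 (negbTE mun0)/= => /eqP E; rewrite -[RHS]E.
  by apply: eq_Rintegral => x _; rewrite mulr1.
have := le_trans (mean0_diffsq u2 I0) (HK _ _ H).
rewrite EE -EFinM lee_fin mulrA ler_pM2r// leNgt => /negP[].
move: muc; rewrite ltr_pdivlMr ?ltr_wpDl//; nra.
Qed.

Lemma neumann0_cst u : neumann_solution Omega 0 u ->
  exists m, is_zero_on Omega (fun x => u x - m).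
Proof.
move=> [g H sol]; apply: (energy0_cst H).
by rewrite (neumann_energy H sol) mul0r.
Qed.

(** Solutions for the eigenvalue 0 are constant, hence two of them are linearly
    dependent. *)
Lemma multiplicity0_le1 : (multiplicity Omega 0 <= 1)%E.
Proof.
apply: ge_ereal_sup => _ [m [u [sol fu]] <-]; rewrite lee_fin.
rewrite leNgt; apply/negP; rewrite ltr1n => m1.
pose i0 : 'I_m := Ordinal (ltnW m1); pose i1 : 'I_m := Ordinal m1.
have [m0 H0] := neumann0_cst (sol i0); have [m1' H1] := neumann0_cst (sol i1).
have i01 : i1 != i0 by [].
have sumE c (x : 'rV[R]_n) : (forall i, i != i0 -> i != i1 -> c i = 0) ->
    \sum_i c i * u i x = c i0 * u i0 x + c i1 * u i1 x.
  move=> c0; rewrite (bigD1 i0)//= (bigD1 i1)//= big1 ?addr0// => i /andP[h1 h2].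
  by rewrite c0 ?mul0r.
(* If the constant m0 is 0, then already u i0 vanishes; otherwise m1' u i0 - m0 u i1
is a nontrivial vanishing combination. *)
have [m00|m0n0] := eqVneq m0 0.
  have := fu (fun i => if i == i0 then 1 else 0).
  move=> /(_ _ i0); rewrite eqxx => h.
  suff : (1 : R) = 0 by move/eqP; rewrite oner_eq0.
  apply: h; apply: filterS H0 => x Hx Ox.
  rewrite sumE => [|i /negbTE -> //].
  by rewrite eqxx (negbTE i01) mul1r mul0r addr0; have := Hx Ox; rewrite m00 subr0.
have := fu (fun i => if i == i0 then m1' else if i == i1 then - m0 else 0).
move=> /(_ _ i1); rewrite (negbTE i01) eqxx => h.
move: m0n0; rewrite -oppr_eq0 h ?eqxx//.
apply: filterS2 H0 H1 => x Hx0 Hx1 Ox.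
rewrite sumE => [|i /negbTE -> /negbTE -> //].
rewrite !eqxx (negbTE i01).
move/eqP: (Hx0 Ox); rewrite subr_eq0 => /eqP ->.
move/eqP: (Hx1 Ox); rewrite subr_eq0 => /eqP ->; ring.
Qed.

(** Below the gap only the eigenvalue 0 can be counted, at most once, whereas
    mu_k requires a count of k + 1 >= 2. *)
Lemma neumann_eigenvalue_gt0 k : (1 <= k)%N -> (0 < neumann_eigenvalue k Omega)%E.
Proof.
move=> k1; have [c c0 Hc] := eigenvalue_gap.
apply: (@lt_le_trans _ _ c%:E) => //; apply: le_ereal_inf_tmp => _ [mu [emu kmu] <-].
rewrite lee_fin leNgt; apply/negP => muc.
move: kmu; rewrite leNgt => /negP; apply.
apply: (@le_lt_trans _ _ 1%E); last by rewrite lte_fin ltr1n ltnS.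
rewrite /eigenvalue_count.
have /subset_set1[->|->] : [set mu' | is_eigenvalue Omega mu' /\ mu' <= mu] `<=` [set 0].
- by move=> mu' [emu' mumu]; apply: Hc => //; exact: le_lt_trans muc.
- by rewrite esum_set0.
rewrite esum_set1; first exact: multiplicity0_le1.
apply: ereal_sup_ubound; exists 0%N => //.
by exists (fun=> cst 0); split=> [[]//|c' _ []].
Qed.

End gap.

(** * Cutting off at the ends of an interval *)

Section cutoff.
Context (R : realType).
Implicit Types s y L w : R.

Lemma abs_sin_le y : 0 <= y -> `|sin y| <= y.
Proof.
move=> y0.
have [c _] := @MVT_segment R sin cos 0 y y0 (fun x _ => is_derive_sin x)
  (continuous_subspaceT (@continuous_sin R)).
rewrite sin0 !subr0 => ->; rewrite normrM (ger0_norm y0) ler_piMl//.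
by rewrite ler_norml cos_geN1 cos_le1.
Qed.

Lemma abs_sin_natpi (j : nat) y : `|sin (pi *+ j - y)| = `|sin y|.
Proof.
rewrite addrC (alternatingn (@sinDpi R)) normrM normrX normrN1 expr1n mul1r.
by rewrite sinN normrN.
Qed.

(** With z = s / (y - s) the left-hand side is (z + z^2) exp (- z), and exp z is
    at least (1 + z / 2)^2. *)
Lemma edge_derivative_bound s y : 0 < s -> 0 <= y -> y * (s * flat 2 s (y - s)) <= 4.
Proof.
move=> s0 y0; rewrite /flat; case: ltP => [t0|_]; last by rewrite !mulr0.
set t := y - s in t0 *; have -> : y = t + s by rewrite /t subrK.
pose z := s / t; have z0 : 0 < z by rewrite divr_gt0.
have -> : (t + s) * (s * (t^-1 ^+ 2 * expR (- s / t))) = (z + z ^+ 2) * expR (- z).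
  have -> : - s / t = - z by rewrite /z mulNr.
  by rewrite /z; move: (expR _) => E; field; rewrite gt_eqF.
rewrite expRN ler_pdivrMr ?expR_gt0//.
have -> : z = z / 2 + z / 2 by lra.
rewrite expRD -expr2.
have h : 1 + z / 2 <= expR (z / 2) by exact: expR_ge1Dx.
have h2 : (1 + z / 2) ^+ 2 <= expR (z / 2) ^+ 2.
  by rewrite lerXn2r// nnegrE; lra.
by move: h2; move: (expR _) => E; nra.
Qed.

Lemma cvg_shrink y : y - m.+1%:R^-1 @[m --> \oo] --> y.
Proof.
rewrite -[X in _ --> X]subr0; apply: cvgB; first exact: cvg_cst.
exact: (@cvg_harmonic R).
Qed.

Lemma cvg_edge y : 0 < y -> flat 0 m.+1%:R^-1 (y - m.+1%:R^-1) @[m --> \oo] --> (1 : R).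
Proof.
move=> y0.
have H : expR (- (m.+1%:R^-1 * (y - m.+1%:R^-1)^-1)) @[m --> \oo] --> (1 : R).
  rewrite -[X in _ --> X]expR0; apply: continuous_cvg; first exact: continuous_expR.
  rewrite -[X in _ --> X]oppr0; apply: cvgN.
  rewrite -[X in _ --> X](mul0r y^-1); apply: cvgM; first exact: (@cvg_harmonic R).
  by apply: cvgV; [rewrite gt_eqF|exact: cvg_shrink].
apply: cvg_trans H; apply: near_eq_cvg; near=> m.
have t0 : 0 < y - m.+1%:R^-1.
  by near: m; exact: (cvgr_gt y (cvg_shrink (y := y))).
by rewrite /flat t0 expr0 mul1r mulNr.
Unshelve. all: by end_near. Qed.

Lemma cvg_edge_derivative y : 0 < y ->
  m.+1%:R^-1 * flat 2 m.+1%:R^-1 (y - m.+1%:R^-1) @[m --> \oo] --> (0 : R).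
Proof.
move=> y0.
have H : m.+1%:R^-1 * ((y - m.+1%:R^-1)^-1 ^+ 2 * flat 0 m.+1%:R^-1 (y - m.+1%:R^-1))
    @[m --> \oo] --> (0 : R).
  rewrite -[X in _ --> X](mul0r (y^-1 ^+ 2 * 1)); apply: cvgM; first exact: (@cvg_harmonic R).
  apply: cvgM; last exact: cvg_edge.
  have V : (y - m.+1%:R^-1)^-1 @[m --> \oo] --> y^-1.
    by apply: cvgV; [rewrite gt_eqF|exact: cvg_shrink].
  by under eq_fun do rewrite expr2; rewrite expr2; exact: cvgM.
apply: cvg_trans H; apply: near_eq_cvg; near=> m.
by rewrite /flat; case: ifP => _; rewrite ?mulr0// expr0 mul1r.
Unshelve. all: by end_near. Qed.

(** Vanishes within s of the two ends of ]0, L[ and tends to 1 inside as s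
    tends to 0. *)
Definition cutoff s L y : R := flat 0 s (y - s) * flat 0 s (L - y - s).

Definition cutoff' s L y : R :=
  s * flat 2 s (y - s) * flat 0 s (L - y - s) - flat 0 s (y - s) * (s * flat 2 s (L - y - s)).

Lemma cutoffE s L : cutoff s L = bump s s (L - s).
Proof. by apply/funext => y; rewrite /cutoff /bump addrAC. Qed.

Lemma elementary_cutoff s L : 0 < s -> elementary (cutoff s L).
Proof. by rewrite cutoffE; exact: elementary_bump. Qed.

Lemma is_derive_cutoff s L y : 0 < s -> is_derive y (1 : R) (cutoff s L) (cutoff' s L y).
Proof.
move=> s0.
have d1 : is_derive y (1 : R) (fun y : R => y - s) 1.
  have := is_deriveB (is_derive_id y (1 : R)) (is_derive_cst s y (1 : R)).
  by rewrite subr0.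
have d2 : is_derive y (1 : R) (fun y : R => L - y - s) (- 1).
  have := is_deriveB (is_deriveB (is_derive_cst L y (1 : R)) (is_derive_id y (1 : R)))
    (is_derive_cst s y (1 : R)).
  by rewrite subr0 sub0r.
have e1 := @is_derive1_comp _ (flat 0 s) (fun z : R => z - s) y _ _ (is_derive_flat 0 (y - s) s0) d1.
have e2 := @is_derive1_comp _ (flat 0 s) (fun z : R => L - z - s) y _ _ (is_derive_flat 0 (L - y - s) s0) d2.
apply: (is_derive_eq (is_deriveM e1 e2)).
by rewrite /cutoff' /GRing.scale/=; ring.
Qed.

Lemma cutoff_ge0 s L y : 0 <= cutoff s L y.
Proof. by rewrite mulr_ge0// flat_ge0. Qed.

Lemma cutoff_le1 s L y : 0 < s -> cutoff s L y <= 1.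
Proof. by move=> s0; rewrite mulr_ile1 ?flat_ge0 ?flat0_le1. Qed.

Lemma cutoff_support s L y : cutoff s L y != 0 -> s <= y <= L - s.
Proof.
rewrite cutoffE; apply: contraR => h; apply/eqP/bump_eq0.
by apply: contra h => /andP[h1 h2]; rewrite !ltW.
Qed.

Lemma cvg_cutoff L y : 0 < y < L -> cutoff m.+1%:R^-1 L y @[m --> \oo] --> (1 : R).
Proof.
move=> /andP[y0 yL]; rewrite -[X in _ --> X](mulr1 1).
by apply: cvgM; apply: cvg_edge; rewrite ?subr_gt0.
Qed.

Lemma cvg_cutoff' L y : 0 < y < L -> cutoff' m.+1%:R^-1 L y @[m --> \oo] --> (0 : R).
Proof.
move=> /andP[y0 yL]; rewrite -[X in _ --> X](_ : 0 * 1 - 1 * 0 = _); last by rewrite mul0r mulr0 subr0.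
by apply: cvgB; apply: cvgM; do ?[exact: cvg_edge|exact: cvg_edge_derivative|
  apply: cvg_edge; rewrite subr_gt0|apply: cvg_edge_derivative; rewrite subr_gt0].
Qed.

(** The derivative of the cutoff grows like the inverse of the distance to the
    ends, so it is tamed by a factor that vanishes linearly there.  This is
    what gives an integrable bound independent of s. *)
Lemma cutoff'_bound s L y (S C : R) : 0 < s -> 0 <= y <= L -> 0 <= C ->
  `|S| <= C * y -> `|S| <= C * (L - y) -> `|S * cutoff' s L y| <= 8 * C.
Proof.
move=> s0 /andP[y0 yL] C0 S1 S2; rewrite /cutoff' mulrBr.
have Ly0 : 0 <= L - y by rewrite subr_ge0.
have b1 := edge_derivative_bound s0 y0; have b2 := edge_derivative_bound s0 Ly0.
have g1 : 0 <= s * flat 2 s (y - s) by rewrite mulr_ge0 ?flat_ge0// ltW.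
have g2 : 0 <= s * flat 2 s (L - y - s) by rewrite mulr_ge0 ?flat_ge0// ltW.
have f1 := flat_ge0 0 s (y - s); have f2 := flat_ge0 0 s (L - y - s).
have l1 := flat0_le1 (y - s) s0; have l2 := flat0_le1 (L - y - s) s0.
rewrite (le_trans (ler_normB _ _))//.
have -> : 8 * C = C * 4 + C * 4 by ring.
apply: lerD.
  rewrite normrM (ger0_norm (mulr_ge0 g1 f2)) (@le_trans _ _ (C * y * (s * flat 2 s (y - s))))//.
    by apply: ler_pM => //; [rewrite mulr_ge0|rewrite ler_piMr].
  by rewrite -mulrA ler_wpM2l.
rewrite normrM (ger0_norm (mulr_ge0 f1 g2)).
rewrite (@le_trans _ _ (C * (L - y) * (s * flat 2 s (L - y - s))))//.
  by apply: ler_pM => //; [rewrite mulr_ge0|rewrite ler_piMl].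
by rewrite -mulrA ler_wpM2l.
Qed.

End cutoff.

(** * Boxes and waves *)

Section openbox.
Context (R : realType) (d : nat) (l : 'I_d -> R).
Hypothesis l0 : forall i, 0 < l i.

Definition obox : set 'rV[R]_d := [set x | forall i, 0 < x ord0 i < l i].

Lemma open_obox : open obox.
Proof.
rewrite openE => x xl.
suff : nbhs x (fun y : 'rV[R]_d => forall i, 0 < y ord0 i < l i) by [].
have H i : nbhs x [set y : 'rV[R]_d | 0 < y ord0 i < l i].
  have oi : open ((fun y : 'rV[R]_d => y ord0 i) @^-1` `]0, l i[%classic).
    by apply: open_comp => [y _|]; [exact: coord_continuous|exact: interval_open].
  move: oi; rewrite openE => /(_ x); rewrite /interior/= in_itv/= => /(_ (xl i)).
  by apply: filterS => y; rewrite /= in_itv.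
exact: (@filter_forall _ _ (fun i => [set y : 'rV[R]_d | 0 < y ord0 i < l i]) (nbhs x) _ H).
Qed.

Lemma obox_rbox : obox `<=` rbox 0 (\row_i l i).
Proof. by move=> x xl i; rewrite !mxE; have /andP[h1 h2] := xl i; rewrite !ltW. Qed.

Lemma bounded_obox : bounded_set obox.
Proof.
have [M [Mr HM]] := bounded_rbox (0 : 'rV[R]_d) (\row_i l i).
by exists M; split=> // x Mx y /obox_rbox; exact: HM.
Qed.

Lemma convex_obox : convex_set obox.
Proof.
move=> x y t /set_mem xl /set_mem yl; apply/mem_set => i.
rewrite /conv /= /isConvexSpace.conv /= !mxE /unstable.onem.
have /andP[x1 x2] := xl i; have /andP[y1 y2] := yl i.
have pos (a b p : R) : 0 < a -> 0 < b -> 0 <= p -> p <= 1 -> 0 < p * a + (1 - p) * b.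
  move=> a0 b0 p0 p1; have [->|pn0] := eqVneq p 0; first by lra.
  have pp : 0 < p by rewrite lt_neqAle eq_sym pn0.
  by apply: ltr_pwDl; [exact: mulr_gt0|rewrite mulr_ge0 ?subr_ge0// ltW].
have t0 : 0 <= (t%:num : R) by []. have t1 : (t%:num : R) <= 1 by [].
move: (t%:num : R) t0 t1 => p p0 p1; rewrite pos//=.
have := pos (l i - x ord0 i) (l i - y ord0 i) p; rewrite !subr_gt0 => /(_ x2 y2 p0 p1).
lra.
Qed.

Lemma obox_neq0 : obox !=set0.
Proof.
exists (\row_i (l i / 2)) => i; rewrite mxE; have := l0 i.
by move=> ?; apply/andP; split; lra.
Qed.

Lemma admissible_obox : admissible obox.
Proof. by split; [exact: obox_neq0|exact: bounded_obox|exact: open_obox|exact: convex_obox]. Qed.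

End openbox.

Section waves.
Context (R : realType) (d : nat) (l : 'I_d -> R) (i0 : 'I_d) (w : R).
Local Notation leb := (lebesgue_rV R d).
Local Notation Omega := (obox l).

Let mO : measurable Omega := measurable_openrV (@open_obox R d l).
Let oO : open Omega := @open_obox R d l.
Let bO : bounded_set Omega := @bounded_obox R d l.
Let Ooo : (leb Omega < +oo)%E := bounded_lebesgue_lty mO bO.

Definition wave (x : 'rV[R]_d) : R := cos (w * x ord0 i0).

Definition wave_gradient (i : 'I_d) (x : 'rV[R]_d) : R :=
  if i == i0 then - w * sin (w * x ord0 i0) else 0.

Let wave1 (i : 'I_d) : R -> R := if i == i0 then (fun y => cos (w * y)) else (fun=> 1).

Let elementary_wave1 i : elementary (wave1 i).
Proof.
rewrite /wave1; case: eqP => _; last exact: elem_cst.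
by apply: elem_cos; apply: elem_mul; [exact: elem_cst|exact: elem_id].
Qed.

Let is_derive_lin (y : R) : is_derive y (1 : R) (fun y : R => w * y) w.
Proof.
apply: (is_derive_eq (is_deriveM (is_derive_cst w y (1 : R)) (is_derive_id y (1 : R)))).
by rewrite /GRing.scale/= mulr1 mulr0 addr0.
Qed.

Lemma waveE : wave = tensor wave1.
Proof.
apply/funext => x; rewrite /wave /tensor (bigD1 i0)//= /wave1 eqxx big1 ?mulr1//.
by move=> i /negbTE ->.
Qed.

Lemma smooth_wave : smooth wave.
Proof. by rewrite waveE; exact: smooth_tensor. Qed.

Lemma partial_wave i : partial i wave = wave_gradient i.
Proof.
rewrite waveE partial_tensor; last by move=> j t; exact: elementary_derivable.
apply/funext => x; rewrite /tensor /wave_gradient; case: eqP => [->|/eqP ii0].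
  rewrite (bigD1 i0)//= eqxx big1 ?mulr1; last first.
    by move=> j jn; rewrite /wave1 (negbTE jn).
  rewrite /wave1 eqxx derive1E.
  have := is_derive1_comp (is_derive_cos (w * x ord0 i0)) (is_derive_lin (x ord0 i0)).
  by move=> H; rewrite (@derive_val _ _ _ _ _ _ _ H) mulrC mulNr mulrN.
rewrite (bigD1 i)//= eqxx /wave1 (negbTE ii0) derive1E.
by rewrite derive_cst mul0r.
Qed.

Lemma wave_le1 x : `|wave x| <= 1.
Proof. by rewrite /wave ler_norml cos_geN1 cos_le1. Qed.

Lemma wave_gradient_le i x : `|wave_gradient i x| <= `|w|.
Proof.
rewrite /wave_gradient; case: eqP; rewrite ?normr0// => _.
by rewrite normrM normrN ler_piMr// ler_norml sin_geN1 sin_le1.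
Qed.

Lemma measurable_wave : measurable_fun setT wave.
Proof. exact: (measurable_smooth smooth_wave). Qed.

Lemma measurable_wave_gradient i : measurable_fun setT (wave_gradient i).
Proof. by rewrite -partial_wave; exact: (measurable_partial i smooth_wave). Qed.

(** The integral of a derivative of wave * phi is 0, and the product rule splits
    it into the two integrals of the definition. *)
Lemma H1_wave : H1 Omega wave wave_gradient.
Proof.
split.
- apply: (L2_bounded oO bO (C := 1)); first exact: measurable_funTS measurable_wave.
  by move=> x _; exact: wave_le1.
- move=> i; apply: (L2_bounded oO bO (C := `|w|)).
    exact: measurable_funTS (measurable_wave_gradient i).
  by move=> x _; exact: wave_gradient_le.
move=> i phi tphi; have [sphi _ _] := tphi.
have [C1 HC1] := test_function_bounded tphi.
have [C2 HC2] := test_function_partial_bounded i tphi.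
have m1 : measurable_fun setT (fun x => wave x * partial i phi x).
  by apply: measurable_funM; [exact: measurable_wave|exact: measurable_partial].
have m2 : measurable_fun setT (fun x => wave_gradient i x * phi x).
  by apply: measurable_funM; [exact: measurable_wave_gradient|exact: measurable_smooth].
have dw y : differentiable wave y by exact: (smooth_wave [::]).
have dphi y : differentiable phi y by exact: (sphi [::]).
have DE y : 'D_(delta_mx ord0 i) (wave * phi) y =
    wave y * partial i phi y + wave_gradient i y * phi y.
  rewrite deriveM; [|exact: diff_derivable|exact: diff_derivable].
  by rewrite -partial_wave /partial /GRing.scale/= [X in _ + X]mulrC.
have DEf : 'D_(delta_mx ord0 i) (wave * phi) =
    (fun y => wave y * partial i phi y + wave_gradient i y * phi y).
  by apply/funext.
have j1 : leb.-integrable setT (EFin \o (fun x => wave x * partial i phi x)).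
  apply: (integrable_bounded_support mO Ooo m1 (C := C2)).
    move=> x; rewrite normrM (le_trans _ (HC2 x))// ler_piMl//; exact: wave_le1.
  by move=> x /(test_function_out tphi)[_ ->]; rewrite mulr0.
have j2 : leb.-integrable setT (EFin \o (fun x => wave_gradient i x * phi x)).
  apply: (integrable_bounded_support mO Ooo m2 (C := `|w| * C1)).
    move=> x; rewrite normrM ler_pM//; exact: wave_gradient_le.
  by move=> x /(test_function_out tphi)[->]; rewrite mulr0.
have j12 := integrableD measurableT j1 j2.
have jp : leb.-integrable setT (EFin \o (wave * phi)).
  apply: (integrable_bounded_support mO Ooo (C := C1)).
  - by apply: measurable_funM; [exact: measurable_wave|exact: measurable_smooth].
  - by move=> x; rewrite normrM (le_trans _ (HC1 x))// ler_piMl//; exact: wave_le1.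
  - by move=> x /(test_function_out tphi)[px _]; rewrite /= -[(wave * phi) x]/(wave x * phi x) px mulr0.
have I0 : (\int[leb]_x ('D_(delta_mx ord0 i) (wave * phi) x)%:E = 0)%E.
  apply: integral_derive0 => //.
  - by move=> y; apply: derivableM; exact: diff_derivable.
  - have DEp : 'D_(delta_mx ord0 i) (wave * phi) =
        wave * partial i phi + partial i wave * phi by rewrite DEf partial_wave.
    rewrite DEp => y; apply: differentiable_continuous.
    apply: differentiableD; apply: differentiableM => //.
      exact: (sphi [:: i]).
    exact: (smooth_wave [:: i]).
  - by rewrite DEf.
have : (\int[leb]_x (wave x * partial i phi x)%:E + \int[leb]_x (wave_gradient i x * phi x)%:E = 0)%E.
  rewrite -(integralD measurableT j1 j2) -[RHS]I0; apply: eq_integral => x _.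
  by rewrite DE.
rewrite /Rintegral !(@integral_ext _ _ Omega).
rewrite [X in fine X = _](_ : _ = \int[leb]_x (wave x * partial i phi x)%:E)%E; last first.
  apply: eq_integral => x _; rewrite /ext; case: ifPn => // /negP Ox.
  by have [_ ->] := test_function_out tphi (fun Oy => Ox (mem_set Oy)); rewrite mulr0.
rewrite [X in _ = - fine X](_ : _ = \int[leb]_x (wave_gradient i x * phi x)%:E)%E; last first.
  apply: eq_integral => x _; rewrite /ext; case: ifPn => // /negP Ox.
  by have [-> _] := test_function_out tphi (fun Oy => Ox (mem_set Oy)); rewrite mulr0.
have f1 := integrable_fin_num measurableT j1; have f2 := integrable_fin_num measurableT j2.
rewrite -(fineK f1) -(fineK f2) -EFinD => -[] /eqP; rewrite addr_eq0 => /eqP.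
by rewrite !fineK.
Qed.

Lemma ext_dominated (v : 'rV[R]_d -> R) (phi_ : nat -> 'rV[R]_d -> R)
    (phi : 'rV[R]_d -> R) (C : R) :
  L2 Omega v -> (forall m, measurable_fun setT (phi_ m)) -> measurable_fun setT phi ->
  (forall m x, Omega x -> `|phi_ m x| <= C) ->
  (forall x, Omega x -> phi_ m x @[m --> \oo] --> phi x) ->
  (\int[leb]_x (ext Omega v x * phi_ m x)%R%:E)%E @[m --> \oo] -->
  (\int[leb]_x (ext Omega v x * phi x)%R%:E)%E.
Proof.
move=> v2 mphi_ mphi phiC phi_cvg.
have iv := L2_ext_integrable oO bO v2.
have mv : measurable_fun setT (ext Omega v).
  by apply/measurable_EFinP; exact: measurable_int iv.
have [||||| _ _] := @dominated_convergence _ _ _ leb setT measurableT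
  (fun m x => (ext Omega v x * phi_ m x)%R%:E)
  (fun x => (ext Omega v x * phi x)%R%:E) (fun x => (`|C|%:E * `|(ext Omega v x)%:E|)%E) => //.
- by move=> m; apply/measurable_EFinP; exact: measurable_funM.
- by apply/measurable_EFinP; exact: measurable_funM.
- apply: aeW => x _; apply: cvg_EFin; first by near=> m.
  rewrite /ext; case: ifPn => [/set_mem Ox|_].
    by apply: cvgMr; exact: phi_cvg.
  by under eq_fun do rewrite mul0r; rewrite mul0r; exact: cvg_cst.
- by apply: integrableZl => //; exact: integrable_abse.
- apply: aeW => x m _; rewrite abse_EFin -EFinM lee_fin normrM mulrC.
  rewrite /ext; case: ifPn => [/set_mem Ox|_]; last by rewrite normr0 !mulr0.
  by rewrite ler_wpM2r// (le_trans (phiC m x Ox))// ler_norm.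
Unshelve. all: by end_near. Qed.

End waves.

(** * Waves are Neumann eigenfunctions *)

Section wave_solution.
Context (R : realType) (d : nat) (l : 'I_d -> R) (i0 : 'I_d) (w : R) (j : nat).
Local Notation leb := (lebesgue_rV R d).
Local Notation Omega := (obox l).
Hypotheses (l0 : forall i, 0 < l i) (w0 : 0 <= w) (wl : w * l i0 = pi *+ j).

Let oO : open Omega := @open_obox R d l.
Let bO : bounded_set Omega := @bounded_obox R d l.
Let mO : measurable Omega := measurable_openrV oO.

(** A compactly supported approximation of sin (w x_i0). *)
Definition wave_cutoff (s : R) : 'rV[R]_d -> R :=
  tensor (fun i y => (if i == i0 then sin (w * y) else 1) * cutoff s (l i) y).

Let elementary_sin : elementary (fun y : R => sin (w * y)).
Proof. by apply: elem_sin; apply: elem_mul; [exact: elem_cst|exact: elem_id]. Qed.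

Let elementary_wave_cutoff s (i : 'I_d) : 0 < s ->
  elementary (fun y => (if i == i0 then sin (w * y) else 1) * cutoff s (l i) y).
Proof.
move=> s0; apply: elem_mul; last exact: elementary_cutoff.
by case: (i == i0); [exact: elementary_sin|exact: elem_cst].
Qed.

Lemma test_function_wave_cutoff s : 0 < s -> test_function Omega (wave_cutoff s).
Proof.
move=> s0; apply: (@test_function_tensor _ _ _ (\row_i s) (\row_i (l i - s))).
- by move=> i; exact: elementary_wave_cutoff.
- by move=> i t; rewrite mulf_eq0 negb_or !mxE => /andP[_ /cutoff_support].
by move=> x xs i; have := xs i; rewrite !mxE => /andP[h1 h2]; apply/andP; split; lra.
Qed.

Definition wave_cutoff' (s : R) (x : 'rV[R]_d) : R :=
  (w * cos (w * x ord0 i0) * cutoff s (l i0) (x ord0 i0) +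
   sin (w * x ord0 i0) * cutoff' s (l i0) (x ord0 i0)) *
  \prod_(i | i != i0) cutoff s (l i) (x ord0 i).

Lemma partial_wave_cutoff s : 0 < s -> partial i0 (wave_cutoff s) = wave_cutoff' s.
Proof.
move=> s0; rewrite /wave_cutoff partial_tensor; last first.
  by move=> i t; apply: elementary_derivable; exact: elementary_wave_cutoff.
apply/funext => x; rewrite /tensor (bigD1 i0)//= eqxx /wave_cutoff'; congr (_ * _); last first.
  by apply: eq_bigr => i /negbTE ->; rewrite mul1r.
rewrite derive1E; move: (x ord0 i0 : R) => y.
have d1 := is_deriveM (is_derive_cst w y (1 : R)) (is_derive_id y (1 : R)).
have d2 := is_derive1_comp (is_derive_sin (w * y)) d1.
have d3 := is_deriveM d2 (is_derive_cutoff (l i0) y s0).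
rewrite (@derive_val _ _ _ _ _ _ _ d3) /GRing.scale/=.
by ring.
Qed.

Let prod_cutoff_le1 s (x : 'rV[R]_d) (P : pred 'I_d) : 0 < s ->
  `|\prod_(i | P i) cutoff s (l i) (x ord0 i)| <= 1 :> R.
Proof.
move=> s0; rewrite normr_prod; apply: (@le_trans _ _ (\prod_(i < d | P i) 1)); last by rewrite big1.
by apply: ler_prod => i _; rewrite normr_ge0 ger0_norm ?cutoff_ge0// cutoff_le1.
Qed.

Lemma wave_cutoff_le1 s x : 0 < s -> `|wave_cutoff s x| <= 1.
Proof.
move=> s0; rewrite /wave_cutoff /tensor big_split/= normrM mulr_ile1//; last exact: prod_cutoff_le1.
rewrite normr_prod; apply: (@le_trans _ _ (\prod_(i < d) 1)); last by rewrite big1.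
apply: ler_prod => i _; rewrite normr_ge0; case: (i == i0) => /=; last by rewrite normr1.
by rewrite ler_norml sin_geN1 sin_le1.
Qed.

(** The sine vanishes at both ends of the side i0, which compensates the growth
    of the derivative of the cutoff; the other cutoffs are not differentiated. *)
Lemma wave_cutoff'_bound s x : 0 < s -> Omega x -> `|wave_cutoff' s x| <= 9 * w.
Proof.
move=> s0 xl; have /andP[x0 x1] := xl i0.
rewrite /wave_cutoff' normrM -[leRHS]mulr1 ler_pM//; last exact: prod_cutoff_le1.
rewrite (le_trans (ler_normD _ _))// (_ : 9 * w = w + 8 * w); last by ring.
apply: lerD.
  have c1 : `|cos (w * x ord0 i0)| <= 1 by rewrite ler_norml cos_geN1 cos_le1.
  have c2 : `|cutoff s (l i0) (x ord0 i0)| <= 1 by rewrite ger0_norm ?cutoff_ge0// cutoff_le1.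
  rewrite 2!normrM (ger0_norm w0) -mulrA ler_piMr//.
  by rewrite mulr_ile1.
apply: cutoff'_bound => //; first by rewrite !ltW.
  by apply: abs_sin_le; rewrite mulr_ge0// ltW.
rewrite -(abs_sin_natpi j) -wl -mulrBr.
by apply: abs_sin_le; rewrite mulr_ge0// subr_ge0 ltW.
Qed.

Let cvg_prod_cutoff (x : 'rV[R]_d) (P : pred 'I_d) : Omega x ->
  \prod_(i | P i) cutoff m.+1%:R^-1 (l i) (x ord0 i) @[m --> \oo] --> (1 : R).
Proof.
move=> xl; rewrite [X in _ --> X](_ : _ = \prod_(i < d | P i) 1); last by rewrite big1.
elim: (index_enum _) => [|i r IHr].
  by under eq_fun do rewrite big_nil; rewrite big_nil; exact: cvg_cst.
under eq_fun do rewrite big_cons; rewrite big_cons.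
by case: (P i) => //; apply: cvgM => //; exact: cvg_cutoff.
Qed.

Lemma cvg_wave_cutoff x : Omega x ->
  wave_cutoff m.+1%:R^-1 x @[m --> \oo] --> sin (w * x ord0 i0).
Proof.
move=> xl.
have E s : wave_cutoff s x = sin (w * x ord0 i0) * \prod_i cutoff s (l i) (x ord0 i).
  rewrite /wave_cutoff /tensor big_split/= [X in X * _](bigD1 i0)//= eqxx big1 ?mulr1//.
  by move=> i /negbTE ->.
rewrite (_ : (fun m : nat => _) = (fun m : nat => sin (w * x ord0 i0) *
    \prod_i cutoff m.+1%:R^-1 (l i) (x ord0 i))); last by apply/funext => m; rewrite E.
by rewrite -[X in _ --> X]mulr1; apply: cvgMr; exact: cvg_prod_cutoff.
Qed.

Lemma cvg_wave_cutoff' x : Omega x ->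
  wave_cutoff' m.+1%:R^-1 x @[m --> \oo] --> w * cos (w * x ord0 i0).
Proof.
move=> xl; rewrite /wave_cutoff' -[X in _ --> X]mulr1.
apply: cvgM; last exact: cvg_prod_cutoff.
rewrite -[X in _ --> X]addr0; apply: cvgD.
  by rewrite -[X in _ --> X]mulr1; apply: cvgMr; exact: cvg_cutoff.
by rewrite -[X in _ --> X](mulr0 (sin (w * x ord0 i0))); apply: cvgMr; exact: cvg_cutoff'.
Qed.

(** The function sin (w x_i0) is not a test function, but it vanishes on the two
    faces orthogonal to i0, which are the only ones that a derivative in the
    direction i0 sees.  So the weak gradient may be tested with it, by passing
    to the limit in its compactly supported approximations. *)
Lemma wave_ibp v h : H1 Omega v h ->
  (\int[leb]_x (ext Omega v x * (w * cos (w * x ord0 i0)))%R%:E =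
   - \int[leb]_x (ext Omega (h i0) x * sin (w * x ord0 i0))%R%:E)%E.
Proof.
move=> H; have [v2 h2 _] := H.
have s0 m : 0 < m.+1%:R^-1 :> R by [].
have tf m := test_function_wave_cutoff (s0 m).
have mcoord : measurable_fun setT (fun x : 'rV[R]_d => w * x ord0 i0).
  by apply: measurable_funM => //; exact: measurable_coordR.
have c1 := @ext_dominated R d l v (fun m => wave_cutoff' m.+1%:R^-1)
  (fun x => w * cos (w * x ord0 i0)) (9 * w) v2.
have c2 := @ext_dominated R d l (h i0) (fun m => wave_cutoff m.+1%:R^-1)
  (fun x => sin (w * x ord0 i0)) 1 (h2 i0).
have {}c1 := c1 _ _ _ _.
have {}c1 : (\int[leb]_x (ext Omega v x * wave_cutoff' m.+1%:R^-1 x)%R%:E)%E @[m --> \oo] -->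
    (\int[leb]_x (ext Omega v x * (w * cos (w * x ord0 i0)))%R%:E)%E.
  apply: c1.
  - by move=> m; rewrite -partial_wave_cutoff//; apply: measurable_partial; have [] := tf m.
  - apply: measurable_funM => //.
    exact: (measurableT_comp (continuous_measurable_fun (@continuous_cos R)) mcoord).
  - by move=> m x; exact: wave_cutoff'_bound.
  - exact: cvg_wave_cutoff'.
have {}c2 : (\int[leb]_x (ext Omega (h i0) x * wave_cutoff m.+1%:R^-1 x)%R%:E)%E @[m --> \oo] -->
    (\int[leb]_x (ext Omega (h i0) x * sin (w * x ord0 i0))%R%:E)%E.
  apply: c2.
  - by move=> m; apply: measurable_smooth; have [] := tf m.
  - exact: (measurableT_comp (continuous_measurable_fun (@continuous_sin R)) mcoord).
  - by move=> m x _; exact: wave_cutoff_le1.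
  - exact: cvg_wave_cutoff.
have E m : (\int[leb]_x (ext Omega v x * wave_cutoff' m.+1%:R^-1 x)%R%:E =
    - \int[leb]_x (ext Omega (h i0) x * wave_cutoff m.+1%:R^-1 x)%R%:E)%E.
  by rewrite -partial_wave_cutoff//; exact: (weak_gradient_ext oO bO i0 H (tf m)).
have {}c2 := cvgeN c2.
rewrite (_ : (fun m => _) = (fun m => (- \int[leb]_x (ext Omega (h i0) x * wave_cutoff m.+1%:R^-1 x)%R%:E)%E)) in c1.
  exact: (cvg_unique _ c1 (c2 _)).
by apply/funext.
Qed.

(** The gradient of the wave is - w sin (w x_i0) in the direction i0, so the
    weak equation is integration by parts against this sine. *)
Lemma neumann_solution_wave : neumann_solution Omega (w ^+ 2) (wave i0 w).
Proof.
have HW := @H1_wave R d l i0 w; have [w2 g2 _] := HW.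
exists (wave_gradient i0 w) => // v h H; have [v2 h2 _] := H.
have mcoord : measurable_fun setT (fun x : 'rV[R]_d => w * x ord0 i0).
  by apply: measurable_funM => //; exact: measurable_coordR.
have i1 : leb.-integrable setT (EFin \o (fun x => ext Omega v x * (w * cos (w * x ord0 i0)))).
  apply: (integrable_mul_bounded (C := w) measurableT (L2_ext_integrable oO bO v2)).
    apply: measurable_funM => //.
    exact: (measurableT_comp (continuous_measurable_fun (@continuous_cos R)) mcoord).
  by move=> x _; rewrite normrM (ger0_norm w0) ler_piMr// ler_norml cos_geN1 cos_le1.
have i2 : leb.-integrable setT (EFin \o (fun x => ext Omega (h i0) x * sin (w * x ord0 i0))).
  apply: (integrable_mul_bounded (C := 1) measurableT (L2_ext_integrable oO bO (h2 i0))).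
    exact: (measurableT_comp (continuous_measurable_fun (@continuous_sin R)) mcoord).
  by move=> x _; rewrite ler_norml sin_geN1 sin_le1.
have f1 := integrable_fin_num measurableT i1; have f2 := integrable_fin_num measurableT i2.
have ibp := wave_ibp H.
have E1 : \int[leb]_(x in Omega) (\sum_i wave_gradient i0 w i x * h i x) =
    - w * fine (\int[leb]_x (ext Omega (h i0) x * sin (w * x ord0 i0))%R%:E)%E.
  rewrite -[- w]/(fine (- w)%:E) -fineM// -integralZl// /Rintegral (@integral_ext _ _ Omega); congr fine.
  apply: eq_integral => x _; rewrite -EFinM /ext; congr EFin; case: ifP => _; last by rewrite mul0r mulr0.
  rewrite (bigD1 i0)//= big1 ?addr0; last first.
    by move=> i ii0; rewrite /wave_gradient (negbTE ii0) mul0r.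
  by rewrite /wave_gradient eqxx; ring.
have E2 : w ^+ 2 * \int[leb]_(x in Omega) (wave i0 w x * v x) =
    w * fine (\int[leb]_x (ext Omega v x * (w * cos (w * x ord0 i0)))%R%:E)%E.
  have iwv := integrable_L2M oO w2 v2.
  rewrite expr2 -mulrA; congr (_ * _).
  rewrite -(RintegralZl w mO iwv) /Rintegral (@integral_ext _ _ Omega); congr fine.
  apply: eq_integral => x _; congr EFin; rewrite /ext; case: ifP => _; last by rewrite mul0r.
  by rewrite /wave; ring.
by rewrite E1 E2 ibp fineN mulNr mulrN.
Qed.

(** Near the face x_i0 = 0 the argument of the cosine stays below pi / 2. *)
Lemma wave_not_zero : ~ is_zero_on Omega (wave i0 w).
Proof.
pose l' i := if i == i0 then l i / (2 * j.+1%:R) else l i.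
have l'0 i : 0 < l' i by rewrite /l'; case: ifP => // _; rewrite divr_gt0.
have l'l i : l' i <= l i.
  rewrite /l'; case: ifP => // _; rewrite ler_pdivrMr// ler_peMr ?ltW//.
  have : 1 <= j.+1%:R :> R by rewrite ler1n.
  by move: (j.+1%:R : R) => z; lra.
have pos x : obox l' x -> 0 < wave i0 w x.
  move=> xl; have := xl i0; rewrite /l' eqxx => /andP[x0 x1].
  apply: cos_gt0_pihalf; apply/andP; split.
    by rewrite (lt_le_trans (y := 0)) ?oppr_lt0 ?divr_gt0 ?pi_gt0// mulr_ge0// ltW.
  have h : w * x ord0 i0 <= w * (l i0 / (2 * j.+1%:R)) by rewrite ler_wpM2l// ltW.
  apply: (le_lt_trans h); rewrite mulrA wl -[pi *+ j]mulr_natr.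
  rewrite ltr_pdivrMr// (_ : pi / 2 * (2 * j.+1%:R) = pi * j.+1%:R); last first.
    by rewrite mulrA divfK.
  by rewrite ltr_pM2l ?pi_gt0// ltr_nat.
have [_ _ oU _] := admissible_obox l'0.
move=> zw; have U0 := open_lebesgue_gt0 oU (obox_neq0 l'0).
suff /measure_negligible E : leb.-negligible (obox l').
  by move: U0; rewrite E ?ltxx//; exact: measurable_openrV.
apply: negligibleS zw => x xl' /= zx; have := pos x xl'.
rewrite zx ?ltxx// => i; have /andP[h1 h2] := xl' i.
by rewrite h1 (lt_le_trans h2).
Qed.

Lemma multiplicity_wave_ge1 : (1 <= multiplicity Omega (w ^+ 2))%E.
Proof.
apply: ereal_sup_ubound; exists 1%N => //; exists (fun=> wave i0 w); split.
  by move=> _; exact: neumann_solution_wave.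
move=> c zc i; apply/eqP/negP => /negP ci; apply: wave_not_zero.
apply: filterS zc => x h Ox; have := h Ox.
rewrite big_ord1 -(ord1 i : i = ord0).
by move/eqP; rewrite mulf_eq0 (negbTE ci) => /eqP.
Qed.

Lemma is_eigenvalue_wave : is_eigenvalue Omega (w ^+ 2).
Proof. by exists (wave i0 w); [exact: neumann_solution_wave|exact: wave_not_zero]. Qed.

End wave_solution.

(** The waves with 0, ..., k half-periods along the side i0 contribute k + 1
    distinct eigenvalues, and the given bound is the largest of them. *)
Lemma neumann_eigenvalue_obox_le (R : realType) (d k : nat) (l : 'I_d -> R) (i0 : 'I_d) :
  (forall i, 0 < l i) ->
  (neumann_eigenvalue k (obox l) <= ((pi *+ k / l i0) ^+ 2)%:E)%E.
Proof.
move=> l0; pose w j : R := pi *+ j / l i0.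
have w0 j : 0 <= w j by rewrite divr_ge0// ?(ltW (l0 i0))// mulrn_wge0// pi_ge0.
have wl j : w j * l i0 = pi *+ j by rewrite divfK// gt_eqF.
apply: ereal_inf_lbound; exists (w k ^+ 2) => //; split.
  exact: (is_eigenvalue_wave l0 (w0 k) (wl k)).
have winj : set_inj `I_k.+1 (fun j => w j ^+ 2).
  move=> j j' _ _ /eqP; rewrite eqrXn2// => /eqP.
  move=> wjj; have pp : pi *+ j = pi *+ j' :> R by rewrite -(wl j) wjj wl.
  have pn0 : pi != 0 :> R by rewrite gt_eqF// pi_gt0.
  by apply/eqP; rewrite -(eqr_nat R) -(inj_eq (mulfI pn0)) !mulr_natr pp.
apply: esum_ge; exists [set w j ^+ 2 | j in `I_k.+1].
  split; first exact/finite_image/finite_II.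
  move=> _ [j /= jk <-]; split; first exact: (is_eigenvalue_wave l0 (w0 j) (wl j)).
  rewrite lerXn2r ?nnegrE// ler_pM2r ?invr_gt0//.
  by rewrite -[pi *+ j]mulr_natr -[pi *+ k]mulr_natr ler_wpM2l ?pi_ge0// ler_nat.
rewrite fsbig_image// -(fsbig_ord _ _ (fun j => multiplicity (obox l) (w j ^+ 2))).
apply: (@le_trans _ _ (\sum_(j < k.+1) 1%E)%E).
  by rewrite sumEFin sumr_const card_ord.
by apply: lee_sum => j _; exact: (multiplicity_wave_ge1 l0 (w0 j) (wl j)).
Qed.

(** * Positivity of the perimeter *)

Section euclidean.
Context (R : realType) (n : nat).
Implicit Types (x y : 'rV[R]_n) (U : set 'rV[R]_n).

Lemma coord_le_enorm x i : `|x ord0 i| <= enorm x.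
Proof.
rewrite /enorm -sqrtr_sqr ler_wsqrtr// (bigD1 i)//= lerDl.
by apply: sumr_ge0 => j _; exact: sqr_ge0.
Qed.

Lemma enorm_le x (r : R) : 0 <= r -> (forall i, `|x ord0 i| <= r) -> enorm x <= n%:R * r.
Proof.
move=> r0 xr; rewrite /enorm -(ger0_norm (mulr_ge0 (ler0n R n) r0)) -sqrtr_sqr ler_wsqrtr//.
apply: (@le_trans _ _ (\sum_(i < n) r ^+ 2)).
  by apply: ler_sum => i _; rewrite -real_normK ?num_real// lerXn2r ?nnegrE.
rewrite sumr_const card_ord -[leLHS]mulr_natl exprMn ler_wpM2r ?sqr_ge0//.
by rewrite -natrX ler_nat; case: n => // m; rewrite expnS leq_pmulr.
Qed.

Lemma ediam_ge0 U : (0 <= ediam U)%E.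
Proof. by apply: ereal_sup_ubound; left. Qed.

Lemma ediam0 : ediam (set0 : set 'rV[R]_n) = 0%E.
Proof.
apply/eqP; rewrite eq_le ediam_ge0 andbT; apply: ge_ereal_sup => _ [->//|[x []]].
Qed.

Lemma enorm_le_ediam U x y : U x -> U y -> ((enorm (x - y))%:E <= ediam U)%E.
Proof. by move=> Ux Uy; apply: ereal_sup_ubound; right; exists x => //; exists y. Qed.

Lemma ediam_le U (r : R) : 0 <= r -> (forall x y, U x -> U y -> forall i, `|x ord0 i - y ord0 i| <= r) ->
  (ediam U <= (n%:R * r)%:E)%E.
Proof.
move=> r0 Ur; apply: ge_ereal_sup => _ [->|[x Ux [y Uy <-]]]; first by rewrite lee_fin mulr_ge0.
by rewrite lee_fin enorm_le// => i; rewrite !mxE; exact: Ur.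
Qed.

Lemma measurable_unit_ball : measurable [set x : 'rV[R]_n | enorm x <= 1].
Proof.
rewrite (_ : [set x : 'rV[R]_n | _] = (fun x : 'rV[R]_n => \sum_i x ord0 i ^+ 2) @^-1` `]-oo, 1]%classic).
  rewrite -[X in measurable X]setTI.
  have mf : measurable_fun setT (fun x : 'rV[R]_n => \sum_i x ord0 i ^+ 2).
    apply: measurable_sum => i; apply: measurable_funX; exact: measurable_coordR.
  by apply: mf => //; exact: measurable_itv.
apply/seteqP; split => x /=; rewrite in_itv/= /enorm => h.
  by rewrite -ler_sqrt ?ltr01// sqrtr1.
by rewrite -[leRHS]sqrtr1 ler_wsqrtr.
Qed.

(** The unit ball lies between two cubes; its volume is the normalizing factor
    of the Hausdorff measure, so both bounds matter. *)
Lemma unit_ball_volume_fin : (0 < unit_ball_volume R n < +oo)%E.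
Proof.
apply/andP; split.
  have r0 : 0 < n.+1%:R^-1 :> R by rewrite invr_gt0.
  apply: (@lt_le_trans _ _ (lebesgue_rV R n (cube n.+1%:R^-1))).
    by apply: lebesgue_rbox_gt0 => i; rewrite !mxE gtrN.
  apply: le_measure; rewrite ?inE; [exact: measurable_rbox|exact: measurable_unit_ball|].
  move=> x xr /=; rewrite (@le_trans _ _ (n%:R * n.+1%:R^-1))//.
    by apply: enorm_le => [|i]; [exact: ltW|rewrite ler_norml; have := xr i; rewrite !mxE].
  by rewrite ler_pdivrMr// mul1r ler_nat.
apply: (@le_lt_trans _ _ (lebesgue_rV R n (cube 1))); last exact: lebesgue_rbox_lty.
apply: le_measure; rewrite ?inE; [exact: measurable_unit_ball|exact: measurable_rbox|].
move=> x x1 i; rewrite !mxE -ler_norml; exact: le_trans (coord_le_enorm x i) x1.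
Qed.

Lemma ediam_subset U V : U `<=` V -> (ediam U <= ediam V)%E.
Proof.
move=> UV; apply: ge_ereal_sup => _ [->|[x Ux [y Uy <-]]]; first exact: ediam_ge0.
by apply: enorm_le_ediam; exact: UV.
Qed.

End euclidean.

Section perimeter_gt0.
Context (R : realType) (n : nat).
Local Notation leb := (lebesgue_rV R n).

Definition vtail (x : 'rV[R]_n.+1) : 'rV[R]_n := \row_j x ord0 (lift ord0 j).

Lemma ball_rV_cons (e s t : R) (p q : 'rV[R]_n) : `|s - t| < e ->
  (forall j, `|p ord0 j - q ord0 j| < e) ->
  ball (rV_cons (s, p)) e (rV_cons (t, q)).
Proof.
move=> st pq; split; first exact: le_lt_trans st.
by move=> i j; case: (unliftP ord0 j) => [k|] jE; rewrite !mxE jE ?liftK ?unlift_none; [exact: pq|exact: st].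
Qed.

(** Follow the line over q up to the supremum of the parameters for which it is
    in Omega. *)
Lemma boundary_over (Omega : set 'rV[R]_n.+1) (t : R) (q : 'rV[R]_n) :
  bounded_set Omega -> Omega (rV_cons (t, q)) ->
  exists2 z, (closure Omega `\` Omega^°) z & vtail z = q.
Proof.
move=> bO Ot; pose S := [set t | Omega (rV_cons (t, q))].
have [r r0 Or] := bounded_sub_cube bO.
have hS : has_sup S.
  split; first by exists t.
  by exists r => s /Or /(_ ord0); rewrite !mxE unlift_none/= => /andP[_].
exists (rV_cons (sup S, q)); last by apply/rowP => j; rewrite !mxE liftK.
split.
  move=> B /nbhs_ballP[e e0 zB].
  have [s Ss ss] := sup_adherent e0 hS.
  exists (rV_cons (s, q)); split => //; apply/zB/ball_rV_cons.
    rewrite ger0_norm ?subr_ge0; last exact: (ub_le_sup (proj2 hS)).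
    by rewrite ltrBlDr addrC -ltrBlDr.
  by move=> j; rewrite subrr normr0.
move=> /nbhs_ballP[e /= e0 zO].
have : S (sup S + e / 2).
  apply/zO/ball_rV_cons; last by move=> j; rewrite subrr normr0.
  by rewrite opprD addrA subrr sub0r normrN gtr0_norm ?divr_gt0//; lra.
by move=> /(ub_le_sup (proj2 hS)); rewrite gerDl leNgt divr_gt0.
Qed.

Lemma open_contains_slice (Omega : set 'rV[R]_n.+1) : open Omega -> Omega !=set0 ->
  exists t p e, 0 < e /\ forall q, rbox (p - const_mx e) (p + const_mx e) q -> Omega (rV_cons (t, q)).
Proof.
rewrite openE => oO [x Ox]; have /nbhs_ballP[e /= e0 xO] := oO _ Ox.
exists (x ord0 ord0), (vtail x), (e / 2); split; first by rewrite divr_gt0.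
move=> q pq; apply: xO.
rewrite [X in ball X](_ : _ = rV_cons (x ord0 ord0, vtail x)); last first.
  by apply/rowP => j; rewrite !mxE; case: (unliftP ord0 j) => [k ->|->] //=; rewrite mxE.
apply: ball_rV_cons; first by rewrite subrr normr0.
move=> j; have := pq j; rewrite !mxE distrC => h.
rewrite (@le_lt_trans _ _ (e / 2))//; last by lra.
by rewrite ler_distl.
Qed.

(** Projecting along the first coordinate does not increase distances, so a set
    of diameter D projects into a box of side 2 D.  A cover of the boundary
    thus yields a cover by boxes of the projection, which contains a box Q, and
    the volumes of these boxes are the terms of the Hausdorff sum up to the
    factor K. *)
Lemma perimeter_gt0 (Omega : set 'rV[R]_n.+1) : (0 < n)%N ->
  bounded_set Omega -> open Omega -> Omega !=set0 -> (0 < perimeter Omega)%E.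
Proof.
move=> n0 bO oO O0.
have [t [p [e [e0 HQ]]]] := open_contains_slice oO O0.
set Q := rbox _ _ in HQ.
have Q0 : (0 < leb Q)%E by apply: lebesgue_rbox_gt0 => i; rewrite !mxE; lra.
have Qfin : leb Q \is a fin_num by rewrite ge0_fin_numE ?measure_ge0//; exact: lebesgue_rbox_lty.
have /andP[V0 Voo] := unit_ball_volume_fin R n.
have Vfin : unit_ball_volume R n \is a fin_num by rewrite ge0_fin_numE// ltW.
set V := unit_ball_volume R n in V0 Voo Vfin.
have V0' : 0 < fine V by rewrite fine_gt0// V0.
(* A term V (D / 2)^n of the Hausdorff sum is K^-1 times the volume (2 D)^n of a box. *)
pose K := 4 ^+ n / fine V.
have K0 : 0 < K by rewrite divr_gt0// exprn_gt0.
apply: (@lt_le_trans _ _ (K^-1%:E * leb Q)%E); first by rewrite mule_gt0// lte_fin invr_gt0.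
apply: (@le_trans _ _ (hausdorff_pre n 1 (closure Omega `\` Omega^°))); last first.
  by rewrite /perimeter/=; apply: ereal_sup_ubound; exists 1 => //=.
apply: le_ereal_inf_tmp => _ [U [cU dU] <-].
rewrite -/V.
have dfin i : ediam (U i) \is a fin_num.
  by rewrite ge0_fin_numE ?ediam_ge0// (le_lt_trans (dU i))// ltry.
pose D i := fine (ediam (U i)).
have D0 i : 0 <= D i by rewrite fine_ge0// ediam_ge0.
have DE i : ediam (U i) = (D i)%:E by rewrite fineK.
(* If U i is empty then get (U i) is an arbitrary point, which is harmless: the
box has side 2 D i = 0. *)
pose c i : 'rV[R]_n := vtail (get (U i)).
pose B i := rbox (c i - const_mx (D i)) (c i + const_mx (D i)).
have termE i : (V * (ediam (U i) * 2^-1%:E) ^+ n = (K^-1)%:E * leb (B i))%E.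
  rewrite lebesgue_rbox (eq_bigr (fun=> 2 * D i)); last first.
    move=> j _; rewrite !mxE (_ : _ - _ = 2 * D i); last by ring.
    by apply/max_idPr; rewrite mulr_ge0.
  rewrite prodr_const card_ord DE -EFinM -EFin_expe -(fineK Vfin) -!EFinM; congr EFin.
  rewrite /K invfM invrK mulrAC !exprMn exprVn (_ : 4 = 2 * 2 :> R); last by ring.
  by rewrite exprMn; field; rewrite ?expf_neq0//.
under eq_eseriesr do rewrite termE.
rewrite nneseriesZl//; apply: lee_wpmul2l; first by rewrite lee_fin invr_ge0 ltW.
apply: measure_sigma_subadditive => [i||]; [exact: measurable_rbox|exact: measurable_rbox|].
move=> q Qq; have [z zb zq] := boundary_over bO (HQ q Qq).
have [i _ Uz] := cU _ zb; exists i => // j.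
have Uc : U i (get (U i)) by exact: (getI Uz).
have := le_trans _ (enorm_le_ediam Uz Uc).
move=> /(_ `|z ord0 (lift ord0 j) - get (U i) ord0 (lift ord0 j)|%:E).
rewrite DE !lee_fin -zq /c; rewrite !mxE -ler_distl => H; apply: H.
have := coord_le_enorm (z - get (U i)) (lift ord0 j); rewrite !mxE; exact.
Qed.

End perimeter_gt0.

(** * The perimeter of a long box *)

Section box_perimeter.
Context (R : realType) (n M : nat).
Hypotheses (n0 : (0 < n)%N) (M0 : (0 < M)%N).

Definition long_side (i : 'I_n.+1) : R := if i == ord0 then M%:R else 1.

Lemma long_side_gt0 i : 0 < long_side i.
Proof. by rewrite /long_side; case: ifP; rewrite ?ltr0n. Qed.

Lemma unit_interval_of (m : nat) (y : R) : (0 < m)%N -> 0 <= y <= m%:R ->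
  exists a : 'I_m, a%:R <= y <= a%:R + 1.
Proof.
case: m => // m _; elim: m => [|m IHm] /andP[y0 ym].
  by exists ord0; rewrite y0 add0r.
have [ymm|ymm] := leP y m.+1%:R.
  have [|a ha] := IHm; first by rewrite y0.
  by exists (widen_ord (leqnSn _) a).
by exists ord_max; rewrite ltW//= natr1.
Qed.

(** A cell of side 1 / N: the index i and the boolean b select a face of the
    box, f the position of the cell in it, and a the unit piece of the long
    side that contains the first coordinate. *)
Definition face_cell (N : nat) (c : 'I_M * 'I_n.+1 * bool * {ffun 'I_n -> 'I_N}) :
    set 'rV[R]_n.+1 :=
  let: (a, i, b, f) := c in
  [set x | x ord0 i = (if b then long_side i else 0) /\
    forall j : 'I_n, (f j)%:R <=
      N%:R * (x ord0 (lift i j) - (if lift i j == ord0 then a%:R else 0)) <= (f j)%:R + 1].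

Lemma ediam_face_cell N c : (0 < N)%N ->
  (ediam (@face_cell N c) <= (n.+1%:R * N%:R^-1)%:E)%E.
Proof.
move=> N0; move: c => [[[a i] b] f]; apply: ediam_le; first by rewrite invr_ge0.
move=> x y [xi xj] [yi yj] k; case: (unliftP i k) => [j ->|->]; last first.
  by rewrite xi yi subrr normr0 invr_ge0.
have := xj j; have := yj j.
set s : R := (if _ then _ else _) => /andP[y1 y2] /andP[x1 x2].
have N0' : 0 < N%:R :> R by rewrite ltr0n.
rewrite -(ler_pM2l N0') divff ?gt_eqF// -[X in X * `|_|](ger0_norm (ltW N0')) -normrM ler_norml.
rewrite (_ : N%:R * (_ - _) = N%:R * (x ord0 (lift i j) - s) - N%:R * (y ord0 (lift i j) - s)); last by ring.
move: y1 y2 x1 x2; move: (N%:R * _ : R) (N%:R * _ : R) ((f j)%:R : R) => p q t *.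
by apply/andP; split; lra.
Qed.

Lemma boundary_face_cells N : (0 < N)%N ->
  closure (obox long_side) `\` (obox long_side)^° `<=` [set x | exists c, @face_cell N c x].
Proof.
move=> N0 x [xcl xint].
have xb : rbox 0 (\row_i long_side i) x.
  by apply: closed_rbox; apply: closure_subset xcl; exact: obox_rbox.
have {}xb i : 0 <= x ord0 i <= long_side i by have := xb i; rewrite !mxE.
have [i xi] : exists i, ~ (0 < x ord0 i < long_side i).
  apply/existsNP => xo; apply: xint; have := open_obox (l := long_side).
  by rewrite openE => H; exact: H _ xo.
have [b xib] : exists b : bool, x ord0 i = if b then long_side i else 0.
  have /andP[h1 h2] := xb i; move: xi => /negP; rewrite negb_and -!leNgt => /orP[h|h].
    by exists false; apply/eqP; rewrite eq_le h h1.
  by exists true; apply/eqP; rewrite eq_le h h2.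
have [a xa] : exists a : 'I_M, a%:R <= x ord0 ord0 <= a%:R + 1.
  by apply: unit_interval_of => //; have := xb ord0; rewrite /long_side eqxx.
have H (j : 'I_n) : exists m : 'I_N, m%:R <=
    N%:R * (x ord0 (lift i j) - (if lift i j == ord0 then a%:R else 0)) <= m%:R + 1.
  apply: unit_interval_of => //; set y := x ord0 _ - _.
  have /andP[y0 y1] : 0 <= y <= 1.
    rewrite /y; have := xb (lift i j); rewrite /long_side; case: ifP => [/eqP ->|_].
      by move: xa => /andP[h1 h2] _; rewrite subr_ge0 h1 lerBlDl.
    by rewrite subr0.
  by rewrite mulr_ge0//= ler_piMr.
have [f Hf] := choice H.
exists (a, i, b, [ffun j => f j]); split => // j.
by rewrite ffunE.
Qed.

(** There are 2 M (n + 1) N^n cells, of diameter at most (n + 1) / N; the powers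
    of N cancel, so the bound persists as N grows and the diameters tend to 0. *)
Lemma perimeter_long_box_le :
  (perimeter (obox long_side) <=
    (M%:R * (n.+1%:R * 2 * (n.+1%:R / 2) ^+ n * fine (unit_ball_volume R n)))%:E)%E.
Proof.
have /andP[V0 Voo] := unit_ball_volume_fin R n.
have Vfin : unit_ball_volume R n \is a fin_num by rewrite ge0_fin_numE// ltW.
rewrite /perimeter /hausdorff/=.
set V := unit_ball_volume R n in V0 Voo Vfin *.
apply: ge_ereal_sup => _ [delta /= delta0 <-].
have [N N0 Nd] : exists2 N, (0 < N)%N & n.+1%:R * N%:R^-1 <= delta.
  have := archi_boundP (ltW (divr_gt0 (ltr0Sn R n) delta0)).
  set N := Num.bound _ => h.
  have N0 : 0 < N%:R :> R by apply: le_lt_trans h; rewrite divr_ge0// ltW.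
  exists N; first by rewrite -(ltr0n R).
  by rewrite ler_pdivrMr// mulrC -ler_pdivrMr// ltW.
pose T := ('I_M * 'I_n.+1 * bool * {ffun 'I_n -> 'I_N})%type.
(* The cells enumerated as a sequence, continued by empty sets, whose diameter is 0. *)
pose U k := [set x : 'rV[R]_n.+1 | exists2 c : T, enum_rank c = k :> nat & face_cell c x].
pose D : R := n.+1%:R * N%:R^-1.
have D0 : 0 <= D by rewrite mulr_ge0// invr_ge0.
have dU k : (ediam (U k) <= D%:E)%E.
  have [[c ck]|H] := pselect (exists c : T, enum_rank c = k :> nat).
    apply: le_trans (ediam_face_cell c N0); apply: ediam_subset => x [c' ck' c'x].
    suff -> : c = c' by [].
    by apply/enum_rank_inj/val_inj; rewrite /= ck ck'.
  rewrite (_ : U k = set0) ?ediam0//.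
  by apply/seteqP; split => // x [c ck _]; apply: H; exists c.
have U0 k : (#|{: T}| <= k)%N -> U k = set0.
  move=> Tk; apply/seteqP; split => // x [c ck _].
  by move: Tk; rewrite -ck leqNgt ltn_ord.
apply: (@le_trans _ _ (\sum_(0 <= i <oo) (V * (ediam (U i) * (2^-1)%:E) ^+ n))%E).
  apply: ereal_inf_lbound; exists U => //; split.
    move=> x /(boundary_face_cells N0)[c cx]; exists (enum_rank c : nat) => //.
    by exists c.
  by move=> i; rewrite (le_trans (dU i))// lee_fin.
have t0 i : (0 <= V * (ediam (U i) * (2^-1)%:E) ^+ n)%E.
  by rewrite mule_ge0 ?expe_ge0 ?mule_ge0 ?ediam_ge0// ltW.
rewrite (nneseries_split _ #|{: T}|)// add0n [X in (_ + X)%E]eseries0 ?adde0; last first.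
  by move=> i Ti _; rewrite U0// ediam0 mul0e; case: (n) n0 => // m _; rewrite expeS mul0e mule0.
apply: (@le_trans _ _ (\sum_(0 <= i < #|{: T}|) (fine V * (D / 2) ^+ n)%:E)%E).
  apply: lee_sum => i _; rewrite EFinM fineK// lee_wpmul2l ?(ltW V0)//.
  have di : ediam (U i) \is a fin_num.
    by rewrite ge0_fin_numE ?ediam_ge0// (le_lt_trans (dU i))// ltry.
  have := dU i; rewrite -(fineK di) -EFinM -EFin_expe !lee_fin => h.
  by rewrite lerXn2r ?nnegrE ?mulr_ge0 ?fine_ge0 ?ediam_ge0 ?ler_wpM2r// invr_ge0.
rewrite big_mkord sumEFin sumr_const card_ord lee_fin.
rewrite !card_prod card_ffun !card_ord card_bool -[leLHS]mulr_natl !natrM natrX /D !exprMn.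
have NN : N%:R ^+ n * N%:R^-1 ^+ n = 1 :> R.
  by rewrite -exprMn divff ?expr1n// pnatr_eq0 -lt0n.
rewrite le_eqVlt; apply/orP; left; apply/eqP.
transitivity (N%:R ^+ n * N%:R^-1 ^+ n *
  (M%:R * (n.+1%:R * 2 * (n.+1%:R ^+ n * 2^-1 ^+ n) * fine V))); first by ring.
by rewrite NN mul1r.
Qed.

End box_perimeter.

(** * The shape functional *)

Lemma shape_functional_gt0 (R : realType) (d k : nat) (Omega : set 'rV[R]_d) :
  (2 <= d)%N -> (1 <= k)%N -> admissible Omega -> (0 < shape_functional k Omega)%E.
Proof.
move=> d2 k1 [ neO bO oO cO]; rewrite /shape_functional mule_gt0//.
  by apply: poweR_gt0; case: d d2 Omega neO bO oO cO => // n n1 Omega neO bO oO _; exact: perimeter_gt0.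
exact: neumann_eigenvalue_gt0.
Qed.

(** The perimeter is at most C M with C M >= 1, and 2 / n <= 1, so its power is
    still at most C M, while the eigenvalue is at most (k pi)^2 / M^2. *)
Lemma shape_functional_long_box (R : realType) (n k : nat) : (2 <= n)%N -> (1 <= k)%N ->
  exists K : R, forall M, (0 < M)%N ->
    (shape_functional k (obox (@long_side R n M)) <= (K / M%:R)%:E)%E.
Proof.
move=> n2 k1; have n0 : (0 < n)%N by exact: ltnW.
pose C0 : R := n.+1%:R * 2 * (n.+1%:R / 2) ^+ n * fine (unit_ball_volume R n).
pose C := Num.max 1 C0.
exists (C * (pi *+ k) ^+ 2) => M M0.
have M1 : 1 <= M%:R :> R by rewrite ler1n.
have C1 : 1 <= C by rewrite le_max lexx.
have l0 := @long_side_gt0 R n M M0.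
have [B0 bB oB cB] := admissible_obox l0.
have p0 := ltW (perimeter_gt0 n0 bB oB B0).
have pC : (perimeter (obox (@long_side R n M)) <= (C * M%:R)%:E)%E.
  apply: (le_trans (perimeter_long_box_le R n0 M0)).
  by rewrite lee_fin mulrC ler_wpM2r// le_max lexx orbT.
have CM1 : 1 <= C * M%:R by rewrite (le_trans C1)// ler_peMr// (le_trans ler01).
have e0 : 0 <= 2 / n%:R :> R by rewrite divr_ge0.
have e1 : 2 / n%:R <= 1 :> R by rewrite ler_pdivrMr ?ltr0n// mul1r ler_nat.
have pe : (perimeter (obox (@long_side R n M)) `^ (2 / n%:R) <= (C * M%:R)%:E)%E.
  apply: (@le_trans _ _ ((C * M%:R)%:E `^ (2 / n%:R))%E).
    apply: gt0_ler_poweR => //; rewrite in_itv/= ?leey ?p0//.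
    by rewrite lee_fin (le_trans ler01).
  by rewrite poweR_EFin lee_fin -[leRHS]powRr1 ?(le_trans ler01)//; exact: ler_powR.
have mu := neumann_eigenvalue_obox_le k ord0 l0.
have m0 : (0 <= neumann_eigenvalue k (obox (@long_side R n M)))%E.
  exact/ltW/neumann_eigenvalue_gt0.
rewrite /shape_functional/=; apply: (le_trans (lee_pmul (poweR_ge0 _ _) m0 pe mu)).
rewrite -EFinM lee_fin /long_side eqxx expr_div_n le_eqVlt; apply/orP; left; apply/eqP.
by field; rewrite gt_eqF// (lt_le_trans ltr01).
Qed.

Theorem theorem2p9 (R : realType) (d k : nat)
    (hd : (3 <= d)%N) (hk : (1 <= k)%N) :
  ~ exists2 Omega : set 'rV[R]_d, admissible Omega &
      shape_functional k Omega =
      ereal_inf [set shape_functional k O | O in @admissible R d].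
Proof.
move=> [ Omega aO inf_eq].
have := shape_functional_gt0 (ltnW hd) hk aO.
case: d hd Omega aO inf_eq => // n n2 Omega aO inf_eq.
have [K HK] := @shape_functional_long_box R n k n2 hk.
have le M : (0 < M)%N -> (shape_functional k Omega <= (K / M%:R)%:E)%E.
  move=> M0; apply: le_trans (HK M M0); rewrite inf_eq; apply: ereal_inf_lbound.
  exists (obox (@long_side R n M)) => //; exact/admissible_obox/long_side_gt0.
have := le 1%N isT; case: (shape_functional k Omega) le => // r le _.
rewrite lte_fin => r0.
have K0 : 0 <= K by have := le 1%N isT; rewrite lee_fin divr1; exact: le_trans (ltW r0).
have := archi_boundP (divr_ge0 K0 (ltW r0)); set M := Num.bound _ => KM.
have M0 : 0 < M%:R :> R by apply: le_lt_trans KM; rewrite divr_ge0// ltW.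
have := le M; rewrite -(ltr0n R) M0 lee_fin => /(_ isT); rewrite leNgt => /negP; apply.
by rewrite ltr_pdivrMr// mulrC -ltr_pdivrMr.
Qed.
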